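(* Let $\mathcal{H}$ be a complex Hilbert space and let $f:\mathbb{D}\to\mathcal{B}(\mathcal{H})$ be a harmonic function with expansion $$f(z)=\sum_{n=0}^{\infty} A_n z^n+\sum_{n=1}^{\infty} B_n^*\,\overline{z}^n,\qquad z\in\mathbb{D},$$ where $A_n,B_n\in\mathcal{B}(\mathcal{H})$, such that $\|f(z)\|\le 1$ for each $z\in\mathbb{D}$. Then the following hold. (i) For every $\mu\in\mathbb{R}$ and every $r\in[0,1)$, $$|\mathrm{Re}(e^{i\mu}A_0)|+\sum_{n=1}^{\infty}|e^{i\mu}A_n+e^{-i\mu}B_n|\,r^n\le \frac{\sqrt{1+3r^2}}{\sqrt{1-r^2}}\,I .$$ If, in addition, $e^{i\mu}A_n+e^{-i\mu}B_n$ is normal for each $n\in\mathbb{N}$, then the right-hand side of this inequality can be replaced by $\frac{\sqrt{1+r^2}}{\sqrt{1-r^2}}\,I$. (ii) For every $\mu\in\mathbb{R}$ and every $0\le r\le 1/5$, $$\sum_{n=1}^{\infty}\|e^{i\mu}A_n+e^{-i\mu}B_n\|\,r^n\le \|I-\mathrm{Re}(e^{i\mu}A_0)\| .$$ If, moreover, $e^{i\mu}A_n+e^{-i\mu}B_n$ is normal for each $n\in\mathbb{N}$, then this inequality holds for all $0\le r\le 1/3$. (iii) For every $0\le r\le 1/3$, $$\sum_{n=1}^{\infty}|A_n|\,r^n+\sum_{n=1}^{\infty}|B_n^*|\,r^n\le \tfrac12 I .$$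
   Context: $\mathbb{D}=\{z\in\mathbb{C}:|z|<1\}$ and $\mathbb{N}=\{1,2,\dots\}$. $\mathcal{B}(\mathcal{H})$ is the set of bounded linear operators on $\mathcal{H}$, $I$ is the identity operator, $\|\cdot\|$ is the operator norm, $A^*$ is the adjoint of $A$, $\mathrm{Re}(A)=(A+A^* )/2$, and $|A|=(A^*A)^{1/2}$, where $B^{1/2}$ is the unique positive square root of a positive operator $B$. For self-adjoint $A,B\in\mathcal{B}(\mathcal{H})$, $A\le B$ means $\langle Ax,x\rangle\le\langle Bx,x\rangle$ for all $x\in\mathcal{H}$. A function $f:\mathbb{D}\to\mathcal{B}(\mathcal{H})$ is harmonic if and only if it has an expansion $f(z)=\sum_{n=0}^{\infty}A_nz^n+\sum_{n=1}^{\infty}B_n^*\overline{z}^n$ with $A_n,B_n\in\mathcal{B}(\mathcal{H})$, the series converging absolutely and locally uniformly in $\mathbb{D}$. *)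

(* Defs.v *)
From HB Require Import structures.
From mathcomp Require Import all_boot all_order all_algebra.
From mathcomp Require Import sesquilinear.
From mathcomp Require Import all_classical all_reals all_analysis.
From mathcomp Require Import complex.
Set Implicit Arguments.
Unset Strict Implicit.
Unset Printing Implicit Defensive.
Import Order.TTheory GRing.Theory Num.Theory.
Import numFieldNormedType.Exports.
Local Open Scope classical_set_scope.
Local Open Scope ring_scope.

HB.instance Definition _ (R : rcfType) := NormedModule.copy R[i] R[i]^o.

(* The inner product is linear in its first argument and conjugate-linear in
   the second one. *)
HB.mixin Record CompleteNormedModule_isHilbert (R : realType) H
    & CompleteNormedModule R[i] H := {
  inner : {dot H for Num.conj} ;
  sqr_normE : forall x : H, `|x| ^+ 2 = inner x x
}.

#[short(type="hilbertType")]
HB.structure Definition Hilbert (R : realType) :=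
  {H of CompleteNormedModule R[i] H & CompleteNormedModule_isHilbert R H}.

Section BoundedOperators.
Variables (R : realType) (H : hilbertType R).

Definition bounded_linear : {pred H -> H} :=
  mem [set f : H -> H | linear f /\
    exists M : R, forall x, `|f x| <= M%:C%C * `|x|].

Record bop := Bop { bop_fun :> H -> H; _ : bop_fun \in bounded_linear }.
HB.instance Definition _ := [isSub for bop_fun].
HB.instance Definition _ := [Choice of bop by <:].

Let bounded_linear_submod : submod_closed bounded_linear.
Proof.
split; rewrite ?inE.
  split; first by move=> a x y /=; rewrite scaler0 addr0.
  by exists 0 => x /=; rewrite normr0 mul0r.
move=> a f g; rewrite !inE => -[lf [M Mf]] [lg [N Ng]]; split.
  move=> b x y; rewrite !fctE lf lg !scalerDr !scalerA.
  by rewrite (mulrC a) addrACA.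
have aE : `|a| = (complex.Re `|a|)%:C%C.
  by rewrite RRe_real // ger0_real.
exists (complex.Re `|a| * M + N) => x.
rewrite !fctE (le_trans (ler_normD _ _))// normrZ rmorphD rmorphM /= -aE.
by rewrite mulrDl lerD// -mulrA ler_wpM2l.
Qed.

HB.instance Definition _ :=
  GRing.isSubmodClosed.Build R[i] (H -> H) bounded_linear bounded_linear_submod.
HB.instance Definition _ := [SubChoice_isSubLmodule of bop by <:].

Implicit Types A B : bop.

Lemma bop_linear A : linear A.
Proof. by have := valP A; rewrite inE => -[]. Qed.

Lemma bop_bounded A : exists M : R, forall x, `|A x| <= M%:C%C * `|x|.
Proof. by have := valP A; rewrite inE => -[]. Qed.

HB.instance Definition _ A := GRing.isLinear.Build R[i] H H *:%R A (bop_linear A).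

Definition opnorm A : R :=
  sup [set complex.Re `|A x| | x in [set x : H | `|x| <= 1]].

Let ReE (V : normedModType R[i]) (v : V) : (complex.Re `|v|)%:C%C = `|v|.
Proof. by rewrite RRe_real // ger0_real. Qed.

Let opnorm_has_sup A :
  has_sup [set complex.Re `|A x| | x in [set x : H | `|x| <= 1]].
Proof.
split; first by exists (complex.Re `|A 0|), 0 => //=; rewrite normr0.
have [M AM] := bop_bounded A; exists `|M| => _ [x /= x1 <-].
rewrite -lecR ReE (le_trans (AM x))//.
rewrite (@le_trans _ _ (`|M|%:C%C * `|x|))//.
  by rewrite ler_wpM2r// lecR ler_norm.
by rewrite ler_piMr// lecR.
Qed.

Lemma opnorm_le A x : `|A x| <= (opnorm A)%:C%C * `|x|.
Proof.
have [->|x0] := eqVneq x 0; first by rewrite linear0 !normr0 mulr0.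
have nx0 : 0 < `|x| by rewrite normr_gt0.
rewrite -ler_pdivrMr// -(ger0_norm (ltW nx0)) -normfV mulrC -normrZ.
rewrite -linearZ -ReE lecR /opnorm.
apply: (sup_upper_bound (opnorm_has_sup A)).
exists (`|x|^-1 *: x) => //=.
by rewrite normrZ normfV normr_id mulVf// gt_eqF.
Qed.

Let opnorm_leP A (M : R) :
  (forall x, `|x| <= 1 -> `|A x| <= M%:C%C) -> opnorm A <= M.
Proof.
move=> AM; apply: ge_sup; first by case: (opnorm_has_sup A).
by move=> _ [x /= x1 <-]; rewrite -lecR ReE AM.
Qed.

Lemma opnorm_ge0 A : 0 <= opnorm A.
Proof.
apply: (sup_upper_bound (opnorm_has_sup A)); exists 0; rewrite /= ?linear0 ?normr0//.
Qed.

Let opnormC A : R[i] := (opnorm A)%:C%C.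

Let ler_opnormD A B : opnormC (A + B) <= opnormC A + opnormC B.
Proof.
rewrite -rmorphD lecR; apply: opnorm_leP => x x1.
rewrite (le_trans (ler_normD _ _))// rmorphD lerD//.
  by rewrite (le_trans (opnorm_le _ _))// ler_piMr// lecR opnorm_ge0.
by rewrite (le_trans (opnorm_le _ _))// ler_piMr// lecR opnorm_ge0.
Qed.

Let opnormZ_le (a : R[i]) A : opnormC (a *: A) <= `|a| * opnormC A.
Proof.
rewrite -(ReE (a : R[i]^o)) /opnormC -rmorphM lecR; apply: opnorm_leP => x x1.
rewrite rmorphM /= (ReE (a : R[i]^o)) normrZ ler_wpM2l//.
by rewrite (le_trans (opnorm_le _ _))// ler_piMr// lecR opnorm_ge0.
Qed.

Let opnormZ (a : R[i]) A : opnormC (a *: A) = `|a| * opnormC A.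
Proof.
apply/eqP; rewrite eq_le opnormZ_le /=.
have [->|a0] := eqVneq a 0.
  by rewrite normr0 mul0r /opnormC lecR opnorm_ge0.
have := opnormZ_le a^-1 (a *: A).
rewrite scalerA mulVf// scale1r normfV mulrC ler_pdivlMr ?normr_gt0//.
by rewrite mulrC.
Qed.

Let opnorm0_eq0 A : opnormC A = 0 -> A = 0.
Proof.
move=> A0; apply/val_inj/funext => x /=; apply/eqP.
have := opnorm_le A x; rewrite -/(opnormC A) A0 mul0r normr_le0.
by move=> /eqP ->.
Qed.

HB.instance Definition _ :=
  Lmodule_isNormed.Build R[i] bop ler_opnormD opnormZ opnorm0_eq0.

(* Norms of normedModType R[i] take their values in R[i]. *)
Lemma bop_normE A : `|A| = (opnorm A)%:C%C.
Proof. by []. Qed.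

Lemma idop_subproof : (id : H -> H) \in bounded_linear.
Proof.
rewrite inE; split; first by [].
by exists 1 => x; rewrite mul1r.
Qed.
Definition idop : bop := Bop idop_subproof.

Lemma opcomp_subproof A B : (fun x => A (B x)) \in bounded_linear.
Proof.
rewrite inE; split; first by move=> a x y; rewrite !linearP.
exists (opnorm A * opnorm B) => x; rewrite (le_trans (opnorm_le _ _))//.
by rewrite rmorphM -mulrA ler_wpM2l ?opnorm_le// lecR opnorm_ge0.
Qed.
Definition opcomp A B : bop := Bop (opcomp_subproof A B).

(* Exactly one such B exists (Riesz representation); the default 0 of xget is
   never returned. *)
Definition adjoint A : bop :=
  xget 0 [set B : bop | forall x y, inner (A x) y = inner x (B y)].

Definition normalop A := opcomp (adjoint A) A = opcomp A (adjoint A).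

(* In the order of R[i], z <= w requires 'Im z = 'Im w; for self-adjoint A and
   B both sides are real. *)
Definition ople A B := forall x, inner (A x) x <= inner (B x) x.

(* [ople 0 P] says that every inner (P x) x is real and nonnegative, which makes P
   self-adjoint since the scalars are complex.  Such a P exists, and is unique, when
   [ople 0 A]; the default 0 of xget is a junk value for the other A. *)
Definition opsqrt A : bop :=
  xget 0 [set P : bop | ople 0 P /\ opcomp P P = A].

Definition opabs A := opsqrt (opcomp (adjoint A) A).

Definition opRe A : bop := 2^-1 *: (A + adjoint A).

End BoundedOperators.

Section Harmonic.
Variables (R : realType) (H : hilbertType R).

(* The expansion f z = sum_(n >= 0) A n z^n + sum_(n >= 1) (B n)^* (conj z)^n on
   the open unit disc; B 0 is not used, nor are the values of f outside the disc. *)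
Record harmonic_expansion (f : R[i] -> bop H) (A B : nat -> bop H) : Prop := {
  absolute_analytic : forall z : R[i], `|z| < 1 ->
    cvgn (fun N => \sum_(0 <= n < N) `|z ^+ n *: A n|) ;
  absolute_antianalytic : forall z : R[i], `|z| < 1 ->
    cvgn (fun N => \sum_(1 <= n < N) `|z^* ^+ n *: adjoint (B n)|) ;
  locally_uniform : forall z0 : R[i], `|z0| < 1 ->
    exists2 U : set R[i], nbhs z0 U &
      {uniform U, (fun N (z : R[i]) => \sum_(0 <= n < N) z ^+ n *: A n +
        \sum_(1 <= n < N) z^* ^+ n *: adjoint (B n)) @ \oo --> f}
}.

End Harmonic.

Definition expi (R : realType) (mu : R) : R[i] := (cos mu +i* sin mu)%C.

(* The series starts at index 1. *)
Definition has_sum1 (K : numFieldType) (V : normedModType K) (u : nat -> V)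
    (S : V) := \sum_(1 <= n < N) u n @[N --> \oo] --> S.

(* Main.v *)
Require Import Defs.
From mathcomp Require Import all_boot all_order all_algebra.
From mathcomp Require Import all_classical all_reals all_analysis complex.
From mathcomp Require Import sesquilinear.
From mathcomp Require Import cyclic separable cyclotomic.
From mathcomp Require Import ring lra zify.
Import Order.TTheory GRing.Theory Num.Theory.
Import numFieldNormedType.Exports.
Local Open Scope classical_set_scope.
Local Open Scope ring_scope.
Set Implicit Arguments.
Unset Strict Implicit.
Unset Printing Implicit Defensive.

(** Write C_n for e^{i mu} A_n + e^{-i mu} B_n and G for Re (e^{i mu} A_0), so that
    Re (e^{i mu} f(z)) = G + Re (sum of the C_n z^n).  The three inequalities rest on two
    facts about coefficients.

    The first is Parseval's identity on circles ([trig_parseval]), applied to z |-> f(z) x.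
    Since f is contractive, letting the radius tend to 1 gives ([square_sum_le])
      |A_0 x|^2 + sum over n >= 1 of (|A_n x|^2 + |B_n^* x|^2) <= |x|^2,
    and the same inequality for the coefficients G, C_n / 2 and C_n^* / 2 of
    Re (e^{i mu} f).  As <|T| x, x> <= |T x| |x| for every operator T ([rin_opabs]), the
    Cauchy-Schwarz inequality for sums finishes (i) and (iii).  In (i), the sum
      |G x| + sum of r^n |C_n x|, with |G x|^2 + (1/4) sum of |C_n x|^2 <= |x|^2,
    is at most |x| times the square root of 1 + 4 r^2 / (1 - r^2) = (1 + 3 r^2) / (1 - r^2).
    If C_n is normal then |C_n^* x| = |C_n x|, so that the weight 1/4 becomes 1/2 and
    4 r^2 becomes 2 r^2.  In (iii) the constant is the square root of 2 r^2 / (1 - r^2),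
    which equals 1/2 at r = 1/3.

    The second is the operator version of Caratheodory's coefficient inequality: the
    harmonic function I - Re (e^{i mu} f) is positive, its value at 0 is I - G, and hence
    |C_n| <= 2 |I - G| ([opnorm_re_coef_le]).  Indeed the coefficients
    of a positive function T are the averages over the circle of u^* T(z), where u runs
    through the characters, and positivity gives at each point z
      2 Re <u^* T(z) x, y> <= <T(z) x, x> + <T(z) y, y>  since |u| = 1,
    where the right-hand side averages to the same expression for T(0) ([trig_positive]).
    Summing the geometric series gives (ii) for all r <= 1/3.

    Averages over a circle are taken over roots of unity: the partial sums of f are
    trigonometric polynomials, for which such averages are exact, and their norms on the
    circle exceed 1 by arbitrarily little because the expansion converges absolutely
    ([harmonic_trig_bound]).

    Adjoints come from the Riesz representation theorem ([riesz]), and the square root of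
    T^* T from a norm-convergent iteration ([sqrt_iter_cvg]). *)

(** * Real-valued norms and inner products *)

Section Norm.
Variables (R : realType) (V : normedModType R[i]).
Implicit Types x y : V.

(** Norms take values in [R[i]]; the real value makes linear arithmetic over the ordered
    field [R] available. *)
Definition rnorm x : R := complex.Re `|x|.

Lemma rnormE x : `|x| = (rnorm x)%:C%C.
Proof. by rewrite /rnorm RRe_real // ger0_real. Qed.

Lemma rnorm_ge0 x : 0 <= rnorm x.
Proof. by rewrite -lecR -rnormE; exact: normr_ge0. Qed.

Lemma rnorm0 : rnorm (0 : V) = 0.
Proof. by rewrite /rnorm normr0. Qed.

Lemma rnorm_eq0 x : rnorm x = 0 -> x = 0.
Proof. by move=> x0; apply/eqP; rewrite -normr_eq0 rnormE x0 eqxx. Qed.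

Lemma rnormN x : rnorm (- x) = rnorm x.
Proof. by rewrite /rnorm normrN. Qed.

Lemma rnormD x y : rnorm (x + y) <= rnorm x + rnorm y.
Proof. by rewrite -lecR rmorphD /= -!rnormE ler_normD. Qed.

Lemma rnormB x y : rnorm (x - y) = rnorm (y - x).
Proof. by rewrite /rnorm distrC. Qed.

Lemma rnormZ (a : R[i]) x : rnorm (a *: x) = complex.Re `|a| * rnorm x.
Proof. by rewrite /rnorm normrZ [`|x|]rnormE; case: a => a b; rewrite normc_def /=; simpc. Qed.

Lemma rnorm_sum (I : Type) (r : seq I) (P : pred I) (F : I -> V) :
  rnorm (\sum_(i <- r | P i) F i) <= \sum_(i <- r | P i) rnorm (F i).
Proof.
elim/big_rec2 : _ => [|i y x _ h]; first by rewrite rnorm0.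
by rewrite (le_trans (rnormD _ _))// lerD2l.
Qed.

Lemma cvg_rnormP (u : nat -> V) (l : V) :
  u @ \oo --> l <->
  forall e : R, 0 < e -> exists N, forall n, (N <= n)%N -> rnorm (u n - l) <= e.
Proof.
split=> [ul e e0|h].
  have e0' : 0 < e%:C%C by rewrite ltcR.
  have [N _ hN] := (@cvgrPdist_le _ V _ _ _ u l).1 ul _ e0'.
  by exists N => n /hN /=; rewrite rnormE lecR rnormB.
apply/(@cvgrPdist_le _ V) => e e0.
have eE : e = (complex.Re e)%:C%C by rewrite RRe_real// gtr0_real.
have [|N hN] := h (complex.Re e); first by rewrite -ltcR -eE.
by exists N => // n /= /hN; rewrite eE rnormE lecR rnormB.
Qed.

End Norm.

Section Cauchy.
Variables (R : realType) (V : completeNormedModType R[i]).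

Lemma rnorm_cauchy_cvg (u : nat -> V) :
  (forall e : R, 0 < e ->
    exists N, forall m n, (N <= m)%N -> (N <= n)%N -> rnorm (u m - u n) <= e) ->
  exists l : V, u @ \oo --> l.
Proof.
move=> h; suff /cauchy_cvg : cauchy (u @ \oo).
  by move=> ?; exists (lim (u @ \oo)).
apply/cauchy_exP => e e0.
have eE : e = (complex.Re e)%:C%C by rewrite RRe_real// gtr0_real.
have re0 : 0 < complex.Re e by rewrite -ltcR -eE.
have [|N hN] := h (complex.Re e / 2); first by rewrite divr_gt0.
exists (u N); exists N => // n /= Nn.
rewrite -ball_normE /= eE rnormE ltcR (le_lt_trans (hN N n _ _))//.
by rewrite ltr_pdivrMr// ltr_pMr// ltr1n.
Qed.
End Cauchy.

Section ComplexParts.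
Variable R : realType.
Implicit Types z w : R[i].

Lemma ReD z w : complex.Re (z + w) = complex.Re z + complex.Re w.
Proof. by case: z w => [a b] [c d]. Qed.

Lemma ReN z : complex.Re (- z) = - complex.Re z.
Proof. by case: z. Qed.

Lemma ReZ (a : R) z : complex.Re (a%:C%C * z) = a * complex.Re z.
Proof. by case: z => b c /=; rewrite mul0r subr0. Qed.

Lemma Re_iM z : complex.Re ('i%C * z) = - complex.Im z.
Proof. by case: z => b c /=; rewrite mul0r mul1r sub0r. Qed.

Lemma rnorm_real (a : R) : 0 <= a -> rnorm (a%:C%C : R[i]) = a.
Proof. by move=> a0; rewrite /rnorm ger0_norm// lecR. Qed.

End ComplexParts.

Section Inner.
Variables (R : realType) (H : hilbertType R).
Implicit Types x y z : H.

Definition rin x y : R := complex.Re (inner x y).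

Lemma innerC x y : inner x y = (inner y x)^*%C.
Proof. by rewrite hermC expr0 mul1r. Qed.

Lemma innerZl (a : R[i]) x y : inner (a *: x) y = a * inner x y.
Proof. exact: linearZl_LR. Qed.

Lemma innerDr x y z : inner x (y + z) = inner x y + inner x z.
Proof. exact: linearDr. Qed.

Lemma innerBr x y z : inner x (y - z) = inner x y - inner x z.
Proof. exact: linearBr. Qed.

Lemma innerDl x y z : inner (x + y) z = inner x z + inner y z.
Proof. exact: linearDl. Qed.

Lemma innerZr (a : R[i]) x y : inner x (a *: y) = a^*%C * inner x y.
Proof. by rewrite innerC innerZl rmorphM /= -innerC. Qed.

Lemma rinC x y : rin x y = rin y x.
Proof. by rewrite /rin innerC; case: (inner y x). Qed.

Lemma rinDl x y z : rin (x + y) z = rin x z + rin y z.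
Proof. by rewrite /rin linearDl; exact: ReD. Qed.

Lemma rinNl x z : rin (- x) z = - rin x z.
Proof. by rewrite /rin linearNl; exact: ReN. Qed.

Lemma rinZl (a : R) x z : rin (a%:C%C *: x) z = a * rin x z.
Proof. by rewrite /rin innerZl ReZ. Qed.

Lemma rin_suml (I : Type) (r : seq I) (P : pred I) (F : I -> H) z :
  rin (\sum_(i <- r | P i) F i) z = \sum_(i <- r | P i) rin (F i) z.
Proof.
elim/big_rec2 : _ => [|i y x _ <-]; last by rewrite rinDl.
by rewrite /rin linear0l.
Qed.

Lemma rinDr x y z : rin x (y + z) = rin x y + rin x z.
Proof. by rewrite rinC rinDl !(rinC x). Qed.

Lemma rinNr x z : rin x (- z) = - rin x z.
Proof. by rewrite rinC rinNl rinC. Qed.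

Lemma rinZr (a : R) x z : rin x (a%:C%C *: z) = a * rin x z.
Proof. by rewrite rinC rinZl rinC. Qed.

Lemma rin_sumr (I : Type) (r : seq I) (P : pred I) (F : I -> H) z :
  rin z (\sum_(i <- r | P i) F i) = \sum_(i <- r | P i) rin z (F i).
Proof. by rewrite rinC rin_suml; apply: eq_bigr => i _; rewrite rinC. Qed.

Lemma innerE x : inner x x = (rnorm x ^+ 2)%:C%C.
Proof. by rewrite -sqr_normE rnormE -rmorphXn. Qed.

Lemma rinE x : rin x x = rnorm x ^+ 2.
Proof. by rewrite /rin innerE. Qed.

Lemma rnormD_sqr x y : rnorm (x + y) ^+ 2 = rnorm x ^+ 2 + rnorm y ^+ 2 + 2 * rin x y.
Proof. by rewrite -!rinE !rinDl !rinDr (rinC y x); ring. Qed.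

Lemma rnormB_sqr x y : rnorm (x - y) ^+ 2 = rnorm x ^+ 2 + rnorm y ^+ 2 - 2 * rin x y.
Proof. by rewrite rnormD_sqr rnormN rinNr; ring. Qed.

(** A complex inner product is determined by real parts, because the imaginary part of z
    is the real part of - i z. *)
Lemma rin_inner x y z t : (forall a : R[i], rin (a *: x) y = rin (a *: z) t) ->
  inner x y = inner z t.
Proof.
move=> h; have := h 1; have := h 'i%C; rewrite /rin !innerZl !Re_iM !mul1r.
by case: (inner x y) (inner z t) => [a b] [c d] /= /oppr_inj -> ->.
Qed.

(** Cauchy-Schwarz, from expanding the square of |y| x - |x| y. *)
Lemma rin_le x y : rin x y <= rnorm x * rnorm y.
Proof.
have [x0|x0] := eqVneq (rnorm x) 0.
  by rewrite (rnorm_eq0 x0) /rin linear0l /= rnorm0 mul0r.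
have [y0|y0] := eqVneq (rnorm y) 0.
  by rewrite (rnorm_eq0 y0) /rin linear0r /= rnorm0 mulr0.
have px : 0 < rnorm x by rewrite lt_def x0 rnorm_ge0.
have py : 0 < rnorm y by rewrite lt_def y0 rnorm_ge0.
have : 0 <= rnorm ((rnorm y)%:C%C *: x - (rnorm x)%:C%C *: y) ^+ 2 by rewrite sqr_ge0.
rewrite rnormB_sqr -2!rinE !rinZl !rinZr !rinE.
rewrite (_ : _ + _ - _ = (2 * rnorm x * rnorm y) * (rnorm x * rnorm y - rin x y)); last by ring.
by rewrite pmulr_rge0 ?subr_ge0// !mulr_gt0.
Qed.

Lemma rin_norm_le x y : `|rin x y| <= rnorm x * rnorm y.
Proof.
rewrite ler_norml rin_le andbT lerNl -rinNl -(rnormN x).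
exact: rin_le.
Qed.

End Inner.

(** * Adjoints and completeness of the space of operators *)

Section LimitBound.
Variables (R : realType) (V : normedModType R[i]).

Lemma rnorm_lim_le (u : nat -> V) (l z : V) (C : R) N :
  u @ \oo --> l -> (forall n, (N <= n)%N -> rnorm (z - u n) <= C) ->
  rnorm (z - l) <= C.
Proof.
move=> /cvg_rnormP ul h; apply/ler_addgt0Pr => e e0.
have [M hM] := ul e e0; pose n := maxn N M.
rewrite (_ : z - l = (z - u n) + (u n - l)); last by rewrite addrA subrK.
by rewrite (le_trans (rnormD _ _))// lerD ?h ?hM ?leq_maxl ?leq_maxr.
Qed.

End LimitBound.

Section Riesz.
Variables (R : realType) (H : hilbertType R).

(** The vector representing phi is the minimiser of J(x) = |x|^2 - 2 phi(x): by the
    parallelogram law every minimising sequence is Cauchy, and at the minimum the first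
    variation of J, which is 2 (<y, h> - phi(h)), vanishes. *)
Lemma riesz (phi : H -> R) (M : R) :
  (forall x y, phi (x + y) = phi x + phi y) ->
  (forall (a : R) x, phi (a%:C%C *: x) = a * phi x) ->
  (forall x, phi x <= M * rnorm x) ->
  exists y, forall x, rin x y = phi x.
Proof.
move=> phiD phiZ phiM.
pose J x := rnorm x ^+ 2 - 2 * phi x.
have Jlb x : - M ^+ 2 <= J x.
  have h : 0 <= (rnorm x - M) ^+ 2 by rewrite sqr_ge0.
  have := phiM x; rewrite /J; nra.
pose m := inf (range J).
have Jinf : has_inf (range J).
  by split; [exists (J 0), 0 | exists (- M ^+ 2) => _ [x _ <-]].
have mJ x : m <= J x by apply: ge_inf; [exact: (proj2 Jinf) | exists x].
have approx n : exists x, J x < m + n.+1%:R^-1.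
  have [|_ [x _ <-] hx] := inf_adherent (eps := n.+1%:R^-1) _ Jinf.
    by rewrite invr_gt0.
  by exists x.
pose u n := projT1 (cid (approx n)).
have Ju n : J (u n) < m + n.+1%:R^-1 by rewrite /u; case: cid.
have para n k : rnorm (u n - u k) ^+ 2 <= 2 * (n.+1%:R^-1 + k.+1%:R^-1).
  have := mJ ((2^-1)%:C%C *: (u n + u k)).
  have := Ju n; have := Ju k.
  rewrite /J phiZ phiD -(rinE (_ *: _)) rinZl rinZr rinE rnormD_sqr rnormB_sqr.
  move: n.+1%:R^-1 k.+1%:R^-1 => a b; lra.
have inv_small (e : R) : 0 < e -> exists N, forall n, (N <= n)%N -> n.+1%:R^-1 <= e.
  move=> e0; have hN : e^-1 < (Num.bound e^-1)%:R.
    by apply: archi_boundP; rewrite ltW// invr_gt0.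
  exists (Num.bound e^-1) => n Nn; rewrite invf_ple?posrE//; apply/ltW/(lt_le_trans hN).
  by rewrite ler_nat ltnW.
have [y uy] : exists y : H, u @ \oo --> y.
  apply: rnorm_cauchy_cvg => e e0.
  have [|N hN] := inv_small (e ^+ 2 / 4); first by rewrite divr_gt0// exprn_gt0.
  exists N => n k Nn Nk; rewrite -(@ler_pXn2r _ 2)// ?nnegrE ?rnorm_ge0 ?(ltW e0)//.
  move: (para n k) (hN n Nn) (hN k Nk).
  move: n.+1%:R^-1 k.+1%:R^-1 => a b; lra.
exists y => x; rewrite rinC.
(* The limit in n of the inequality m <= J(u n + t x) along the minimising sequence. *)
have var t : 0 <= 2 * t * (rin y x - phi x) + t ^+ 2 * rnorm x ^+ 2.
  apply/ler_addgt0Pr => e e0.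
  pose K := 2 * `|t| * rnorm x.
  have K0 : 0 <= K by rewrite !mulr_ge0// rnorm_ge0.
  have [N1 h1] := inv_small (e / 2) (divr_gt0 e0 (ltr0Sn _ _)).
  have d0 : 0 < e / 2 / (1 + K) by rewrite !divr_gt0// ltr_wpDr.
  have [N2 h2] := (cvg_rnormP u y).1 uy _ d0.
  pose n := maxn N1 N2.
  have := h1 n (leq_maxl _ _); have := h2 n (leq_maxr _ _).
  have := mJ (u n + t%:C%C *: x); have := Ju n.
  rewrite /J rnormD_sqr phiD phiZ rinZr -(rinE (_ *: _)) rinZl rinZr rinE.
  rewrite -[in rin (u n) x](subrK y (u n)) rinDl.
  set w := u n - y; move=> J1 J2 wd h.
  have tw : t * rin w x <= `|t| * (rnorm w * rnorm x).
    by rewrite (le_trans (ler_norm _))// normrM ler_wpM2l// rin_norm_le.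
  have Kw : K * rnorm w <= e / 2.
    rewrite (le_trans (ler_wpM2l K0 wd))// mulrCA ler_piMr//.
      by rewrite divr_ge0// ltW.
    by rewrite ler_pdivrMr ?ltr_wpDr// mul1r lerDr.
  move: J1 J2 h; move: n.+1%:R^-1 => a J1 J2 h.
  by rewrite /K in Kw; lra.
have q1 : 0 < rnorm x ^+ 2 + 1 by rewrite ltr_wpDl// sqr_ge0.
set D := rin y x - phi x in var *.
(* The + 1 keeps the step well defined when x = 0. *)
have := var (- D / (rnorm x ^+ 2 + 1)).
set q := rnorm x ^+ 2 in q1 *.
have -> : 2 * (- D / (q + 1)) * D + (- D / (q + 1)) ^+ 2 * q =
    - (D ^+ 2 * (q + 2) / (q + 1) ^+ 2).
  by field; rewrite gt_eqF.
rewrite oppr_ge0 pmulr_lle0 ?invr_gt0 ?exprn_gt0// pmulr_lle0; last by lra.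
by rewrite le_eqVlt ltNge sqr_ge0 orbF sqrf_eq0 subr_eq0 => /eqP.
Qed.

End Riesz.

Section Operators.
Variables (R : realType) (H : hilbertType R).
Implicit Types (A B C : bop H) (x y : H).

Lemma rnorm_bop A : rnorm A = opnorm A. Proof. by []. Qed.

Lemma opnorm_rle A x : rnorm (A x) <= opnorm A * rnorm x.
Proof. by rewrite -lecR rmorphM /= -!rnormE opnorm_le. Qed.

Lemma opnorm_le_bound A (M : R) : 0 <= M ->
  (forall x, rnorm (A x) <= M * rnorm x) -> opnorm A <= M.
Proof.
move=> M0 h; apply: ge_sup.
  by exists (complex.Re `|A 0|), 0 => //=; rewrite normr0.
move=> _ [x /= x1 <-]; rewrite (le_trans (h x))// ler_piMr//.
by move: x1; rewrite rnormE lecR.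
Qed.

Lemma opnormM A B : opnorm (opcomp A B) <= opnorm A * opnorm B.
Proof.
apply: opnorm_le_bound => [|x]; first by rewrite mulr_ge0 ?opnorm_ge0.
rewrite /= (le_trans (opnorm_rle _ _))// -mulrA ler_wpM2l ?opnorm_ge0//.
exact: opnorm_rle.
Qed.

Lemma bop_ext A B : A =1 B -> A = B.
Proof. by move=> AB; apply/val_inj/funext. Qed.

Lemma bopDr A x y : A (x + y) = A x + A y. Proof. exact: linearD. Qed.
Lemma bopBr A x y : A (x - y) = A x - A y. Proof. exact: linearB. Qed.
Lemma bopZr A (a : R[i]) x : A (a *: x) = a *: A x. Proof. exact: linearZ. Qed.

Lemma bopDE A B x : (A + B) x = A x + B x. Proof. by []. Qed.
Lemma bopBE A B x : (A - B) x = A x - B x. Proof. by []. Qed.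
Lemma bopZE (a : R[i]) A x : (a *: A) x = a *: A x. Proof. by []. Qed.
Lemma opcompE A B x : opcomp A B x = A (B x). Proof. by []. Qed.
Lemma idopE x : idop H x = x. Proof. by []. Qed.

Lemma bop_sumE (I : Type) (r : seq I) (P : pred I) (F : I -> bop H) x :
  (\sum_(i <- r | P i) F i) x = \sum_(i <- r | P i) F i x.
Proof. by elim/big_rec2 : _ => // i y B _ <-. Qed.

Lemma bop_ex (f : H -> H) (M : R) : linear f ->
  (forall x, rnorm (f x) <= M * rnorm x) -> exists A : bop H, A =1 f.
Proof.
move=> fl fM; have fb : f \in @bounded_linear R H.
  rewrite inE; split=> //; exists M => x.
  by rewrite !rnormE -rmorphM lecR.
by exists (Bop fb).
Qed.

(** Operators inherit completeness from H: the pointwise limits are linear, and the Cauchy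
    estimates at each vector are uniform over the unit ball. *)
Lemma bop_cauchy_cvg (u : nat -> bop H) :
  (forall e : R, 0 < e ->
    exists N, forall m n, (N <= m)%N -> (N <= n)%N -> opnorm (u m - u n) <= e) ->
  exists L : bop H, u @ \oo --> L.
Proof.
move=> h.
have pt x : exists l : H, (fun n => u n x) @ \oo --> l.
  apply: rnorm_cauchy_cvg => e e0.
  have x1 : 0 < rnorm x + 1 by rewrite ltr_wpDl// rnorm_ge0.
  have [N hN] := h _ (divr_gt0 e0 x1); exists N => m n Nm Nn.
  have := opnorm_rle (u m - u n) x => /le_trans; apply.
  rewrite (le_trans (ler_wpM2r (rnorm_ge0 _) (hN _ _ Nm Nn)))//.
  by rewrite mulrAC ler_pdivrMr// ler_wpM2l ?(ltW e0)// lerDl.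
pose L x := projT1 (cid (pt x)).
have uL x : (fun n => u n x) @ \oo --> L x by rewrite /L; case: cid.
have Ll : linear L.
  move=> a x y.
  have h1 : (fun n => u n (a *: x + y)) @ \oo --> a *: L x + L y.
    rewrite (_ : (fun _ => _) = fun n => a *: u n x + u n y).
      by apply: cvgD => //; apply: cvgZr.
    by apply/funext => n; rewrite linearP.
  exact: (cvg_unique (@norm_hausdorff _ H) (uL _) h1).
have close e : 0 < e -> exists N, forall n, (N <= n)%N ->
    forall x, rnorm (u n x - L x) <= e * rnorm x.
  move=> e0; have [N hN] := h e e0; exists N => n Nn x.
  apply: (rnorm_lim_le (N := N) (uL x)) => m Nm.
  have := opnorm_rle (u n - u m) x => /le_trans; apply.
  by rewrite ler_wpM2r ?rnorm_ge0 ?hN.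
have [N hN] := close 1 ltr01.
have [|A AL] := bop_ex (M := 1 + opnorm (u N)) Ll.
  move=> x; rewrite -[L x](subrK (u N x)) (le_trans (rnormD _ _))// mulrDl.
  by rewrite lerD ?opnorm_rle// rnormB hN.
exists A; apply/cvg_rnormP => e e0; have [n0 hn] := close e e0.
exists n0 => n /hn hx; apply: opnorm_le_bound => [|x]; first exact: ltW.
by rewrite bopBE AL hx.
Qed.

(** Riesz applied to x |-> Re <A x, y>. *)
Lemma adjoint_ex A : exists B : bop H, forall x y, inner (A x) y = inner x (B y).
Proof.
have pt y : exists z, forall x, rin x z = rin (A x) y.
  apply: (riesz (M := opnorm A * rnorm y)) => [x z|a x|x].
  - by rewrite linearD rinDl.
  - by rewrite linearZ rinZl.
  - rewrite (le_trans (rin_le _ _))// mulrAC ler_wpM2r ?rnorm_ge0//.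
    exact: opnorm_rle.
pose B y := projT1 (cid (pt y)).
have hB x y : inner (A x) y = inner x (B y).
  apply: rin_inner => a; rewrite -linearZ /B; case: cid => z hz /=.
  by rewrite hz.
have Bl : linear B.
  move=> a y z; apply/eqP; rewrite -subr_eq0; apply/eqP/rnorm_eq0/eqP.
  rewrite -sqrf_eq0 -rinE /rin; set w := _ - _.
  have -> : inner w w = 0; last by rewrite eqxx.
  rewrite {2}/w innerBr innerDr innerZr -!hB innerDr innerZr.
  by rewrite subrr.
have [|C CB] := bop_ex (M := opnorm A) Bl; last first.
  by exists C => x y; rewrite CB hB.
move=> y; have [->|y0] := eqVneq (rnorm (B y)) 0.
  by rewrite mulr_ge0 ?opnorm_ge0 ?rnorm_ge0.
have By : 0 < rnorm (B y) by rewrite lt_def y0 rnorm_ge0.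
rewrite -(ler_pM2r By) -expr2 -rinE /rin -hB (le_trans (rin_le _ _))//.
by rewrite mulrAC ler_wpM2r ?rnorm_ge0 ?opnorm_rle.
Qed.

Lemma adjointP A x y : inner (A x) y = inner x (adjoint A y).
Proof.
have [B hB] := adjoint_ex A.
exact: (@xgetPex _ 0 [set B : bop H | forall x y, inner (A x) y = inner x (B y)]
  (ex_intro _ B hB) x y).
Qed.

Lemma rin_adjoint A x y : rin (A x) y = rin x (adjoint A y).
Proof. by rewrite /rin adjointP. Qed.

Lemma opnorm_adjoint A : opnorm (adjoint A) <= opnorm A.
Proof.
apply: opnorm_le_bound => [|y]; first exact: opnorm_ge0.
have [->|y0] := eqVneq (rnorm (adjoint A y)) 0.
  by rewrite mulr_ge0 ?opnorm_ge0 ?rnorm_ge0.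
have By : 0 < rnorm (adjoint A y) by rewrite lt_def y0 rnorm_ge0.
rewrite -(ler_pM2r By) -expr2 -rinE -rin_adjoint (le_trans (rin_le _ _))//.
by rewrite mulrAC ler_wpM2r ?rnorm_ge0 ?opnorm_rle.
Qed.

End Operators.

(** * Symmetric and positive operators *)

Section Symmetric.
Variables (R : realType) (H : hilbertType R).
Implicit Types (A B C : bop H) (x y : H).

Definition symop A := forall x y, rin (A x) y = rin x (A y).

Lemma symop_inner A x : symop A -> inner (A x) x = (rin (A x) x)%:C%C.
Proof.
move=> sA; have := sA ('i%C *: x) x.
rewrite /rin bopZr !innerZl !Re_iM (innerC x).
by case: (inner (A x) x) => a b /= h; congr (_ +i* _)%C; lra.
Qed.

Lemma ople_rin A B : symop A -> symop B ->
  (forall x, rin (A x) x <= rin (B x) x) -> ople A B.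
Proof. by move=> sA sB h x; rewrite !symop_inner// lecR. Qed.

Lemma rin_ople A B x : ople A B -> rin (A x) x <= rin (B x) x.
Proof. by move=> /(_ x); rewrite lecE => /andP[]. Qed.

(** Polarization: the real quadratic form x |-> <A x, x> forces <A x, y> and <x, A y> to
    have equal imaginary parts, and replacing x by i x to have equal real parts. *)
Lemma ople0_symop A : ople 0 A -> symop A.
Proof.
move=> A0.
have Im0 x : complex.Im (inner (A x) x) = 0.
  by have := A0 x; rewrite linear0l lecE => /andP[/eqP].
have ImE x y : complex.Im (inner (A x) y) = complex.Im (inner x (A y)).
  have := Im0 (x + y); rewrite bopDr innerDl !innerDr (innerC x (A y)).
  move: (Im0 x) (Im0 y).
  case: (inner (A x) x) (inner (A y) y) (inner (A x) y) (inner (A y) x).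
  by move=> ? ? [? ?] [? ?] [? ?] /= -> ->; lra.
move=> x y; have := ImE ('i%C *: x) y; rewrite bopZr !innerZl /rin.
by case: (inner (A x) y) (inner x (A y)) => ? ? [? ?] /=; lra.
Qed.

Lemma symop0 : symop 0.
Proof. by move=> x y; rewrite /rin linear0l linear0r. Qed.

Lemma symop_id : symop (idop H). Proof. by []. Qed.

Lemma symopD A B : symop A -> symop B -> symop (A + B).
Proof. by move=> sA sB x y; rewrite !bopDE rinDl rinDr sA sB. Qed.

Lemma symopN A : symop A -> symop (- A).
Proof. by move=> sA x y; rewrite rinNl rinNr sA. Qed.

Lemma symopB A B : symop A -> symop B -> symop (A - B).
Proof. by move=> sA sB; apply/symopD/symopN. Qed.

Lemma symopZ (a : R) A : symop A -> symop (a%:C%C *: A).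
Proof. by move=> sA x y; rewrite !bopZE rinZl rinZr sA. Qed.

Lemma symop_sqr A : symop A -> symop (opcomp A A).
Proof. by move=> sA x y; rewrite !opcompE !sA. Qed.

Lemma symop_adjoint_comp A : symop (opcomp (adjoint A) A).
Proof. by move=> x y; rewrite !opcompE -rin_adjoint rinC -rin_adjoint rinC. Qed.

Lemma opnorm_cvg_rin (u : nat -> bop H) (L : bop H) x y : u @ \oo --> L ->
  forall e : R, 0 < e -> exists N, forall n, (N <= n)%N ->
    `|rin (u n x) y - rin (L x) y| <= e.
Proof.
move=> /cvg_rnormP uL e e0.
have q0 : 0 < rnorm x * rnorm y + 1 by rewrite ltr_wpDl// mulr_ge0 ?rnorm_ge0.
have [N hN] := uL _ (divr_gt0 e0 q0); exists N => n /hN h.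
rewrite -rinNl -rinDl -bopBE (le_trans (rin_norm_le _ _))//.
rewrite (@le_trans _ _ (rnorm (u n - L) * (rnorm x * rnorm y)))//.
  by rewrite mulrA ler_wpM2r ?rnorm_ge0// opnorm_rle.
rewrite (le_trans (ler_wpM2r _ h)) ?mulr_ge0 ?rnorm_ge0//.
by rewrite mulrAC ler_pdivrMr// ler_wpM2l ?(ltW e0)// lerDl.
Qed.

Lemma symop_lim (u : nat -> bop H) (L : bop H) :
  u @ \oo --> L -> (forall n, symop (u n)) -> symop L.
Proof.
move=> uL su x y; apply/eqP; rewrite -subr_eq0 -normr_le0.
apply/ler_addgt0Pr => e e0; rewrite add0r.
have [N1 h1] := opnorm_cvg_rin x y uL (divr_gt0 e0 (ltr0Sn _ 1)).
have [N2 h2] := opnorm_cvg_rin y x uL (divr_gt0 e0 (ltr0Sn _ 1)).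
have := h1 _ (leq_maxl N1 N2); have := h2 _ (leq_maxr N1 N2).
rewrite (rinC (u _ y)) (rinC (L y)) -su.
set a := rin (L x) y; set b := rin x (L y); set c := rin _ _.
by rewrite !ler_norml; lra.
Qed.

(** Symmetry is kept along with the bound since the order of [ople] also compares the
    imaginary parts. *)
Lemma ople_lim (u : nat -> bop H) (L : bop H) (c : R) : u @ \oo --> L ->
  (forall n, symop (u n)) -> (forall n x, rin (u n x) x <= c * rnorm x ^+ 2) ->
  ople L (c%:C%C *: idop H).
Proof.
move=> uL su uc; apply: ople_rin => [| |x].
- exact: symop_lim su.
- exact/symopZ/symop_id.
- rewrite bopZE idopE rinZl rinE; apply/ler_addgt0Pr => e e0.
  have [N h] := opnorm_cvg_rin x x uL e0.
  by have := h N (leqnn N); have := uc N x; rewrite ler_norml; lra.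
Qed.

(** A sequence whose increments are dominated by those of a bounded real sequence is
    Cauchy: the telescoping real increments stay below the distance to the supremum. *)
Lemma bop_cvg_dominated (u : nat -> bop H) (y : nat -> R) (M : R) :
  (forall n, opnorm (u n.+1 - u n) <= y n.+1 - y n) -> (forall n, y n <= M) ->
  exists L : bop H, u @ \oo --> L.
Proof.
move=> uy yM.
have mono m k : opnorm (u (m + k)%N - u m) <= y (m + k)%N - y m.
  elim: k => [|k IHk]; first by rewrite addn0 !subrr -rnorm_bop rnorm0.
  rewrite addnS (_ : _ - _ = (u (m + k).+1 - u (m + k)%N) + (u (m + k)%N - u m)).
    rewrite -rnorm_bop (le_trans (rnormD _ _))// !rnorm_bop.
    by have := uy (m + k)%N; lra.
  by rewrite addrA subrK.
have ndy m k : y m <= y (m + k)%N.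
  by have := le_trans (opnorm_ge0 _) (mono m k); rewrite subr_ge0.
have sy : has_sup (range y).
  by split; [exists (y 0%N), 0%N | exists M => _ [n _ <-]].
have ysup n : y n <= sup (range y).
  by apply: sup_upper_bound => //; exists n.
apply: bop_cauchy_cvg => e e0.
have [_ [N _ <-] hN] := sup_adherent e0 sy; exists N.
have wl m k : (N <= m)%N -> opnorm (u (m + k)%N - u m) <= e.
  move=> Nm; rewrite (le_trans (mono m k))//.
  by have := ysup (m + k)%N; have := ndy N (m - N)%N; rewrite subnKC//; lra.
move=> m n Nm Nn; have [mn|/ltnW nm] := leqP m n.
  by rewrite -rnorm_bop rnormB -(subnKC mn) wl.
by rewrite -(subnKC nm) wl.
Qed.

(** Expand the square: the cross term is - 2 |A x|^2 / c, while the last term is at most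
    |A x|^2 / c. *)
Lemma adjoint_comp_contraction A (c : R) x : 0 < c -> opnorm A ^+ 2 <= c ->
  rnorm (x - (c^-1)%:C%C *: adjoint A (A x)) <= rnorm x.
Proof.
move=> c0 Ac; rewrite -(@ler_pXn2r _ 2)// ?nnegrE ?rnorm_ge0//.
rewrite rnormB_sqr -(rinE (_ *: _)) rinZl !rinZr rinE -rin_adjoint rinE.
have TA : rnorm (adjoint A (A x)) ^+ 2 <= c * rnorm (A x) ^+ 2.
  rewrite (@le_trans _ _ ((opnorm A * rnorm (A x)) ^+ 2))//.
    rewrite ler_pXn2r// ?nnegrE ?mulr_ge0 ?rnorm_ge0 ?opnorm_ge0//.
    rewrite (le_trans (opnorm_rle _ _))// ler_wpM2r ?rnorm_ge0//.
    exact: opnorm_adjoint.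
  by rewrite exprMn ler_wpM2r ?sqr_ge0.
have : c^-1 * (c^-1 * rnorm (adjoint A (A x)) ^+ 2) <= c^-1 * rnorm (A x) ^+ 2.
  by rewrite ler_wpM2l ?invr_ge0 ?(ltW c0)// ler_pdivrMl.
have : 0 <= c^-1 * rnorm (A x) ^+ 2 by rewrite mulr_ge0 ?sqr_ge0 ?invr_ge0 ?ltW.
lra.
Qed.

End Symmetric.

(** * Square roots and absolute values *)

Section SquareRoot.
Variables (R : realType) (H : hilbertType R).
Variable B : bop H.
Hypotheses (sB : symop B) (B1 : opnorm B <= 1).

(** The fixed points Y of this iteration satisfy (I - Y)^2 = I - B; starting at 0
    keeps the iterates in the unit ball. *)
Fixpoint sqrt_iter n : bop H :=
  if n is n'.+1 then (2^-1)%:C%C *: (B + opcomp (sqrt_iter n') (sqrt_iter n')) else 0.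

(** The iteration for the scalar 1, a majorant of the iteration for every B with
    |B| <= 1. *)
Fixpoint sqrt_scal n : R :=
  if n is n'.+1 then 2^-1 * (1 + sqrt_scal n' ^+ 2) else 0.

Lemma opnormZ_real (a : R) (A : bop H) : 0 <= a -> opnorm (a%:C%C *: A) = a * opnorm A.
Proof. by move=> a0; rewrite -rnorm_bop rnormZ ger0_norm ?lecR. Qed.

Lemma opnormD (A C : bop H) : opnorm (A + C) <= opnorm A + opnorm C.
Proof. exact: (@rnormD _ (bop H)). Qed.

Lemma sqrt_scal_ge0 n : 0 <= sqrt_scal n.
Proof. by case: n => //= n; rewrite mulr_ge0 ?invr_ge0// addr_ge0 ?sqr_ge0. Qed.

Lemma sqrt_scal_le1 n : sqrt_scal n <= 1.
Proof.
by elim: n => //= n IHn; have := sqrt_scal_ge0 n; nra.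
Qed.

Lemma sqrt_iter_le n : opnorm (sqrt_iter n) <= sqrt_scal n.
Proof.
elim: n => [|n IHn] /=; first by rewrite -rnorm_bop rnorm0.
rewrite opnormZ_real ?invr_ge0// ler_wpM2l ?invr_ge0//.
rewrite (le_trans (opnormD _ _))// lerD// (le_trans (opnormM _ _))// expr2.
by rewrite ler_pM ?opnorm_ge0.
Qed.

(** The order of the factors matters since X and Y need not commute. *)
Lemma opcomp_sqrB (X Y : bop H) : opcomp X X - opcomp Y Y =
  opcomp X (X - Y) + opcomp (X - Y) Y.
Proof.
apply: bop_ext => x; rewrite bopBE bopDE !opcompE !bopBE.
by rewrite bopBr addrA subrK.
Qed.

Lemma opnorm_sqrB (X Y : bop H) (a b : R) : opnorm X <= a -> opnorm Y <= b ->
  opnorm (opcomp X X - opcomp Y Y) <= (a + b) * opnorm (X - Y).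
Proof.
move=> Xa Yb; rewrite opcomp_sqrB (le_trans (opnormD _ _))// mulrDl lerD//.
  by rewrite (le_trans (opnormM _ _))// ler_wpM2r ?opnorm_ge0.
by rewrite (le_trans (opnormM _ _))// mulrC ler_wpM2r ?opnorm_ge0.
Qed.

(** The increments of the operator iteration are dominated by those of the scalar one:
    both are half a difference of squares. *)
Lemma sqrt_iterS_le n :
  opnorm (sqrt_iter n.+1 - sqrt_iter n) <= sqrt_scal n.+1 - sqrt_scal n.
Proof.
elim: n => [|n IHn].
  by rewrite !subr0; exact: sqrt_iter_le.
have -> : sqrt_iter n.+2 - sqrt_iter n.+1 = (2^-1)%:C%C *:
    (opcomp (sqrt_iter n.+1) (sqrt_iter n.+1) - opcomp (sqrt_iter n) (sqrt_iter n)).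
  by rewrite /= -scalerBr opprD addrACA subrr add0r.
rewrite opnormZ_real ?invr_ge0//.
have := opnorm_sqrB (sqrt_iter_le n.+1) (sqrt_iter_le n).
have := sqrt_scal_ge0 n; have := sqrt_scal_ge0 n.+1.
have := opnorm_ge0 (sqrt_iter n.+1 - sqrt_iter n).
set u := opnorm (sqrt_iter _ - _) in IHn *.
move: (opnorm _) => v.
have -> : sqrt_scal n.+2 - sqrt_scal n.+1 =
    2^-1 * (sqrt_scal n.+1 ^+ 2 - sqrt_scal n ^+ 2) by rewrite /=; ring.
rewrite subr_sqr => u0 a0 b0 vu; rewrite ler_wpM2l ?invr_ge0//.
rewrite (le_trans vu)// mulrC ler_wpM2r ?addr_ge0//.
Qed.

Lemma sqrt_iter_cvg : exists Y : bop H,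
  [/\ symop Y, opnorm Y <= 1 & (2^-1)%:C%C *: (B + opcomp Y Y) = Y].
Proof.
have [Y uY] := bop_cvg_dominated sqrt_iterS_le sqrt_scal_le1.
have Y1 : opnorm Y <= 1.
  rewrite -rnorm_bop -rnormN -sub0r; apply: (rnorm_lim_le (N := 0) uY) => n _.
  by rewrite sub0r rnormN (le_trans (sqrt_iter_le n)) ?sqrt_scal_le1.
exists Y; split=> //.
  apply: (symop_lim uY); elim=> [|n IHn] /=; first exact: symop0.
  by apply/symopZ/symopD => //; exact: symop_sqr.
apply/eqP; rewrite -subr_eq0; apply/eqP/rnorm_eq0/eqP.
rewrite eq_le rnorm_ge0 andbT; apply/ler_addgt0Pr => e e0; rewrite add0r.
have [N hN] := (cvg_rnormP _ _).1 uY _ (divr_gt0 e0 (ltr0Sn _ 1)).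
have h1 := hN N (leqnn N); have h2 := hN N.+1 (leqnSn N).
rewrite (_ : _ - Y = (2^-1)%:C%C *: (opcomp Y Y - opcomp (sqrt_iter N) (sqrt_iter N)) +
    (sqrt_iter N.+1 - Y)); last first.
  by rewrite addrA -scalerDr addrCA subrK.
have n1 := le_trans (sqrt_iter_le N) (sqrt_scal_le1 N).
have hs := opnorm_sqrB Y1 n1; have hB := rnormB Y (sqrt_iter N).
rewrite (le_trans (rnormD _ _))// !rnorm_bop opnormZ_real ?invr_ge0//.
rewrite !rnorm_bop in h1 h2 hB; rewrite hB in hs; lra.
Qed.

End SquareRoot.

Section Opabs.
Variables (R : realType) (H : hilbertType R).
Implicit Types (A : bop H) (x : H).

(** The square root of T = A^* A is obtained by scaling the square root of T / c = I - B,
    where c > |A|^2 makes B a contraction. *)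
Lemma opsqrt_ex A : exists P : bop H,
  ople 0 P /\ opcomp P P = opcomp (adjoint A) A.
Proof.
(* The + 1 keeps c positive when A = 0. *)
pose c := opnorm A ^+ 2 + 1.
have c0 : 0 < c by rewrite ltr_wpDl// sqr_ge0.
pose B : bop H := idop H - (c^-1)%:C%C *: opcomp (adjoint A) A.
have [|| Y [sY Y1 YE]] := @sqrt_iter_cvg R H B.
- exact/symopB/symopZ/symop_adjoint_comp.
- apply: opnorm_le_bound => // x; rewrite mul1r adjoint_comp_contraction//.
  by rewrite /c lerDl.
exists ((Num.sqrt c)%:C%C *: (idop H - Y)); split.
  apply: ople_rin; first exact: symop0.
    by apply/symopZ/symopB.
  move=> x; rewrite {1}/rin linear0l bopZE rinZl mulr_ge0 ?sqrtr_ge0//.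
  rewrite bopBE rinDl rinNl subr_ge0 (le_trans (rin_le _ _))// rinE expr2.
  rewrite ler_wpM2r ?rnorm_ge0// (le_trans (opnorm_rle _ _))//.
  by rewrite ler_piMl ?rnorm_ge0.
apply: bop_ext => x; rewrite !opcompE !bopZE bopZr scalerA.
rewrite -rmorphM -expr2 sqr_sqrtr ?(ltW c0)// !bopBE !idopE bopBr.
have YYx : Y x + Y x = x - (c^-1)%:C%C *: adjoint A (A x) + Y (Y x).
  rewrite -{1 2}YE bopZE bopDE !opcompE bopBE -scalerDl -rmorphD.
  by rewrite (_ : 2^-1 + 2^-1 = 1 :> R) ?scale1r//; field.
have -> : x - Y x - (Y x - Y (Y x)) = x + Y (Y x) - (Y x + Y x).
  by rewrite opprB opprD !addrA (addrAC x).
rewrite YYx -(addrA x (- _)) (addrC x (Y (Y x))) addrKA opprD opprK addrCA subrr addr0.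
by rewrite scalerA -rmorphM divff ?gt_eqF// scale1r.
Qed.

Lemma opabsP A : ople 0 (opabs A) /\
  opcomp (opabs A) (opabs A) = opcomp (adjoint A) A.
Proof.
have [P hP] := opsqrt_ex A.
exact: (@xgetPex _ 0 [set P : bop H | ople 0 P /\ _] (ex_intro _ P hP)).
Qed.

Lemma opabs_sym A : symop (opabs A).
Proof. by apply: ople0_symop; case: (opabsP A). Qed.

(** The quadratic forms of |A|^2 and of A^* A, which are equal, are the squared norms. *)
Lemma rnorm_opabs A x : rnorm (opabs A x) = rnorm (A x).
Proof.
apply/eqP; rewrite -(@eqrXn2 _ 2)// ?rnorm_ge0//; apply/eqP.
rewrite -!rinE opabs_sym -opcompE (proj2 (opabsP A)) opcompE rin_adjoint //.
Qed.

Lemma opnorm_opabs A : opnorm (opabs A) <= opnorm A.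
Proof.
by apply: opnorm_le_bound => [|x]; rewrite ?opnorm_ge0// rnorm_opabs opnorm_rle.
Qed.

Lemma rin_opabs A x : rin (opabs A x) x <= rnorm (A x) * rnorm x.
Proof. by rewrite (le_trans (rin_le _ _))// rnorm_opabs. Qed.

End Opabs.

(** * Fourier analysis on roots of unity *)

Section RootsOfUnity.
Variable R : realType.

Lemma complex_prim_root_ex n : (0 < n)%N -> exists w : R[i], n.-primitive_root w.
Proof.
move=> n0; have [r Dr] := closed_field_poly_normal ('X^n - 1 : {poly R[i]}).
rewrite (monicP _) ?monicXnsubC ?scale1r// in Dr.
have rn : all n.-unity_root r by apply/allP => w; rewrite -root_prod_XsubC -Dr.
have ur : uniq r.
  by rewrite -separable_prod_XsubC -Dr separable_Xn_sub_1// pnatr_eq0 -lt0n.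
have nr : (n <= size r)%N by rewrite -ltnS -(size_prod_XsubC r id) -Dr size_XnsubC.
by have /hasP[w _ pw] := has_prim_root n0 rn ur nr; exists w.
Qed.

Lemma prim_root_norm1 n (w : R[i]) : n.-primitive_root w -> `|w| = 1.
Proof.
move=> pw; apply/eqP; rewrite -(@pexpr_eq1 _ _ n) ?(prim_order_gt0 pw)//.
by rewrite -normrX (prim_expr_order pw) normr1.
Qed.

Lemma mulcJ_norm1 (u : R[i]) : `|u| = 1 -> u^* * u = 1.
Proof. by move=> u1; rewrite mulrC -normCK u1 expr1n. Qed.

Lemma unity_root_conjX n m (u : R[i]) : `|u| = 1 -> (m <= n)%N -> u ^+ n = 1 ->
  u^* ^+ m = u ^+ (n - m).
Proof.
move=> u1 mn un; rewrite -[LHS]mulr1 -un -{1}(subnKC mn) exprD mulrA -exprMn.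
by rewrite mulcJ_norm1// expr1n mul1r.
Qed.

Lemma prim_root_orthogonal n (w : R[i]) a b : n.-primitive_root w ->
  (a < n)%N -> (b < n)%N ->
  \sum_(k < n) (w ^+ (a * k))^* * w ^+ (b * k) = (a == b)%:R * n%:R.
Proof.
move=> pw an bn; have w1 := prim_root_norm1 pw.
have u1 : (w ^+ a)^* * w ^+ a = 1 by rewrite mulcJ_norm1// normrX w1 expr1n.
rewrite (eq_bigr (fun k : 'I_n => ((w ^+ a)^* * w ^+ b) ^+ k)); last first.
  by move=> k _; rewrite exprMn -rmorphXn -!exprM.
have [->|ab] := eqVneq a b.
  rewrite mul1r (eq_bigr (fun=> 1)); first by rewrite sumr_const card_ord.
  by move=> k _; rewrite mulcJ_norm1 ?expr1n// normrX w1 expr1n.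
rewrite mul0r; apply: (@mulfI _ ((w ^+ a)^* * w ^+ b - 1)); last first.
  rewrite mulr0 -subrX1 exprMn -rmorphXn -!exprM mulnC exprM.
  by rewrite mulnC exprM (prim_expr_order pw) !expr1n rmorph1 mulr1 subrr.
rewrite subr_eq0; apply: contra ab => /eqP/(congr1 ( *%R (w ^+ a))).
rewrite mulrA (mulrC (w ^+ a)) u1 mul1r mulr1 => /eqP.
by rewrite (eq_prim_root_expr pw) !modn_small// eq_sym.
Qed.

End RootsOfUnity.

(** A finite family of frequencies that are distinct modulo n: averages over the n-th roots
    of unity then recover every coefficient exactly. *)

Section DiscreteFourier.
Variables (R : realType) (H : hilbertType R) (n : nat) (w : R[i]).
Hypothesis pw : n.-primitive_root w.
Variables (I : finType) (e : I -> nat) (c : I -> H).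
Hypotheses (e_lt : forall i, (e i < n)%N) (e_inj : injective e).

Let v k := \sum_i w ^+ (e i * k) *: c i.

Lemma dft_coef j : \sum_(k < n) (w ^+ (e j * k))^* *: v k = n%:R *: c j.
Proof.
rewrite (eq_bigr (fun k : 'I_n =>
    \sum_i ((w ^+ (e j * k))^* * w ^+ (e i * k)) *: c i)); last first.
  by move=> k _; rewrite scaler_sumr; apply: eq_bigr => i _; rewrite scalerA.
rewrite exchange_big /= (bigD1 j)//= -scaler_suml prim_root_orthogonal// eqxx mul1r.
rewrite big1 ?addr0// => i ij; rewrite -scaler_suml prim_root_orthogonal//.
by rewrite (inj_eq e_inj) eq_sym (negPf ij) mul0r scale0r.
Qed.

Lemma dft_parseval :
  \sum_(k < n) rnorm (v k) ^+ 2 = n%:R * \sum_i rnorm (c i) ^+ 2.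
Proof.
have rinsum k : rnorm (v k) ^+ 2 = \sum_i rin ((w ^+ (e i * k))^* *: v k) (c i).
  rewrite -rinE {2}/v rin_sumr; apply: eq_bigr => i _.
  by rewrite /rin innerZr innerZl.
under eq_bigr do rewrite rinsum.
rewrite exchange_big mulr_sumr /=.
apply: eq_bigr => i _; rewrite -rin_suml dft_coef -rinE.
by rewrite (_ : n%:R = (n%:R : R)%:C%C) ?rinZl// rmorph_nat.
Qed.

End DiscreteFourier.

Section Trig.
Variable R : realType.

(** Over an arbitrary module, so as to serve for operators and for their values at a
    vector. *)
Definition trig (V : lmodType R[i]) (P Q : nat -> V) (M : nat) (z : R[i]) : V :=
  \sum_(0 <= n < M) z ^+ n *: P n + \sum_(1 <= n < M) z^* ^+ n *: Q n.

Variable H : hilbertType R.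
Implicit Types (P Q : nat -> H).

(** On the circle of radius r the power conj(z)^(n+1) has frequency - (n + 1), represented by
    2 M - (n + 1).  With fewer than M analytic and antianalytic terms, all these frequencies are
    distinct modulo 2 M. *)
Let freq M (i : 'I_M + 'I_M.-1) : nat :=
  match i with inl n => n | inr n => (M.*2 - n.+1)%N end.
Let coef P Q M (r : R) (i : 'I_M + 'I_M.-1) : H :=
  match i with inl n => (r ^+ n)%:C%C *: P n | inr n => (r ^+ n.+1)%:C%C *: Q n.+1 end.

Let freq_lt M i : (@freq M i < M.*2)%N.
Proof. by case: i => i /=; have := ltn_ord i; lia. Qed.

Let freq_inj M : injective (@freq M).
Proof.
move=> [] i [] j /= h; have := ltn_ord i; have := ltn_ord j => hi hj;
  by [congr inl; apply: val_inj | exfalso; lia | congr inr; apply: val_inj => /=; lia].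
Qed.

Let trig_dft P Q M (r : R) (w : R[i]) k : M.*2.-primitive_root w ->
  trig P Q M (r%:C%C * w ^+ k) = \sum_i w ^+ (@freq M i * k) *: coef P Q r i.
Proof.
move=> pw; rewrite big_sumType /= /trig; congr (_ + _).
  rewrite big_mkord; apply: eq_bigr => i _.
  by rewrite scalerA exprMn mulnC exprM rmorphXn mulrC.
rewrite big_add1 big_mkord; apply: eq_bigr => i _.
rewrite scalerA rmorphM exprMn mulrC; congr (_ * _ *: _); last first.
  by rewrite rmorphXn; congr (_ ^+ _); exact: conjc_real.
have w1 : `|w ^+ k| = 1 by rewrite normrX (prim_root_norm1 pw) expr1n.
have iM : (i.+1 <= M.*2)%N by have := ltn_ord i; lia.
have wN : w ^+ k ^+ M.*2 = 1 by rewrite exprAC (prim_expr_order pw) expr1n.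
by rewrite (unity_root_conjX w1 iM wN) mulnC exprM.
Qed.

Lemma trig_coef P Q M (r : R) (w : R[i]) n : M.*2.-primitive_root w -> (n < M)%N ->
  \sum_(k < M.*2) (w ^+ (n * k))^* *: trig P Q M (r%:C%C * w ^+ k) =
  M.*2%:R *: ((r ^+ n)%:C%C *: P n).
Proof.
move=> pw nM; under eq_bigr do rewrite trig_dft//.
exact: (dft_coef pw (coef P Q r) (@freq_lt M) (@freq_inj M) (inl (Ordinal nM))).
Qed.

(** Parseval's identity in the form of an inequality: the mean of |trig P Q M z|^2 over the
    circle of radius r is the left-hand side. *)
Lemma trig_parseval P Q M (r K : R) : (0 < M)%N -> 0 <= r -> 0 <= K ->
  (forall z : R[i], `|z| = r%:C%C -> rnorm (trig P Q M z) <= K) ->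
  \sum_(0 <= n < M) (r ^+ n * rnorm (P n)) ^+ 2 +
  \sum_(1 <= n < M) (r ^+ n * rnorm (Q n)) ^+ 2 <= K ^+ 2.
Proof.
move=> M0 r0 K0 h; have N0 : (0 < M.*2)%N by lia.
have [w pw] := complex_prim_root_ex R N0.
have w1 := prim_root_norm1 pw.
have := dft_parseval pw (coef P Q r) (@freq_lt M) (@freq_inj M).
rewrite big_sumType /= => par.
have rZ n (x : H) : rnorm ((r ^+ n)%:C%C *: x) = r ^+ n * rnorm x.
  by rewrite rnormZ ger0_norm ?lecR ?exprn_ge0.
rewrite big_mkord big_add1 big_mkord -(ler_pM2l (_ : 0 < M.*2%:R)) ?ltr0n//.
under eq_bigr do rewrite -rZ.
under [X in _ + X]eq_bigr do rewrite -rZ.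
rewrite -par mulr_natl -[in leRHS](card_ord M.*2) -sumr_const.
apply: ler_sum => k _; rewrite ler_pXn2r ?nnegrE ?rnorm_ge0// -trig_dft//.
apply: h; rewrite normrM ger0_norm ?lecR// normrX w1 expr1n mulr1//.
Qed.

End Trig.

Section TrigPositive.
Variables (R : realType) (H : hilbertType R).
Implicit Types (P Q : nat -> bop H).

Lemma trig_bopE P Q M z x : trig P Q M z x = trig (P^~ x) (Q^~ x) M z.
Proof. by rewrite /trig bopDE !bop_sumE. Qed.

(** The quadratic form of T at x - u y is nonnegative. *)
Lemma ople0_cross (T : bop H) (u : R[i]) x y : ople 0 T -> `|u| = 1 ->
  2 * rin (u^* *: T x) y <= rin (T x) x + rin (T y) y.
Proof.
move=> T0 u1; have sT := ople0_symop T0.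
have := rin_ople (x - u *: y) T0; rewrite {1}/rin linear0l.
rewrite bopBr bopZr !(rinDl, rinDr, rinNl, rinNr).
have -> : rin (u *: T y) (u *: y) = rin (T y) y.
  by rewrite /rin innerZl innerZr mulrA (mulrC u) [_ * u]mulcJ_norm1// mul1r.
have -> : rin (u *: T y) x = rin (T x) (u *: y) by rewrite -bopZr sT rinC.
have -> : rin (u^* *: T x) y = rin (T x) (u *: y) by rewrite /rin innerZl innerZr.
lra.
Qed.

(** The coefficient r^n P_n is the average of u^* T(z) over the circle, with u the n-th
    character; bound each term by [ople0_cross] and recognise the average of T(z) as P_0. *)
Lemma trig_positive P Q M (r : R) n x y : 0 <= r -> (n < M)%N ->
  (forall z : R[i], `|z| = r%:C%C -> ople 0 (trig P Q M z)) ->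
  2 * (r ^+ n * rin (P n x) y) <= rin (P 0%N x) x + rin (P 0%N y) y.
Proof.
move=> r0 nM h; have M0 : (0 < M)%N by lia.
have N0 : (0 < M.*2)%N by lia.
have [w pw] := complex_prim_root_ex R N0.
have w1 := prim_root_norm1 pw.
have natZ m (v t : H) : rin (m%:R *: v) t = m%:R * rin v t.
  by rewrite -rinZl rmorph_nat.
have coefE m (v t : H) : (m < M)%N -> M.*2%:R * (r ^+ m * rin (P m v) t) =
    \sum_(k < M.*2) rin ((w ^+ (m * k))^* *: trig P Q M (r%:C%C * w ^+ k) v) t.
  move=> mM; rewrite -rinZl -natZ -(trig_coef (P^~ v) (Q^~ v) r pw mM) rin_suml.
  by apply: eq_bigr => k _; rewrite trig_bopE.
have coef0E (v : H) : M.*2%:R * rin (P 0%N v) v =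
    \sum_(k < M.*2) rin (trig P Q M (r%:C%C * w ^+ k) v) v.
  rewrite -[rin _ _]mul1r -[1](expr0 r) coefE//; apply: eq_bigr => k _.
  by rewrite mul0n expr0 rmorph1 scale1r.
rewrite -(ler_pM2l (_ : 0 < M.*2%:R)) ?ltr0n// mulrCA coefE// mulrDr !coef0E.
rewrite -big_split mulr_sumr; apply: ler_sum => k _ /=.
apply: (@ople0_cross (trig P Q M (r%:C%C * w ^+ k)) (w ^+ (n * k))); last first.
  by rewrite normrX w1 expr1n.
by apply: h; rewrite normrM ger0_norm ?lecR// normrX w1 expr1n mulr1.
Qed.

End TrigPositive.

(** * Partial sums of a bounded harmonic function *)

Section HarmonicBound.
Variables (R : realType) (H : hilbertType R).

Lemma abs_cvg_tail (V : normedModType R[i]) (u : nat -> V) m :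
  cvgn (fun N => \sum_(m <= n < N) `|u n|) ->
  forall e : R, 0 < e -> exists N, forall j k, (N <= j)%N -> (j <= k)%N ->
    \sum_(j <= n < k) rnorm (u n) <= e.
Proof.
move=> /(@cvg_rnormP R R[i]) h e e0.
have [N hN] := h _ (divr_gt0 e0 (ltr0Sn _ 1)); exists (maxn m N) => j k.
rewrite geq_max => /andP[mj Nj] jk.
have := hN j Nj; have := hN k (leq_trans Nj jk); set l := lim _ => hk hj.
rewrite -(@rnorm_real R (\sum_(j <= n < k) rnorm (u n))); last first.
  by apply: sumr_ge0 => n _; exact: rnorm_ge0.
rewrite rmorph_sum /=; under eq_bigr do rewrite -rnormE.
rewrite (_ : \sum_(_ <= n < _) _ = (\sum_(m <= n < k) `|u n| - l) -
    (\sum_(m <= n < j) `|u n| - l)).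
  rewrite (le_trans (rnormD _ _))// rnormN; lra.
by rewrite (big_cat_nat mj jk) /= opprB addrA subrK addrC addKr.
Qed.

Lemma harmonic_trig_cvg (f : R[i] -> bop H) (A B : nat -> bop H) (z : R[i]) :
  harmonic_expansion f A B -> `|z| < 1 ->
  (fun N => trig A (fun n => adjoint (B n)) N z) @ \oo --> f z.
Proof.
move=> [_ _ loc] z1; have [U zU h] := loc z z1.
have : [set z] `<=` U by move=> _ ->; exact: nbhs_singleton.
by move=> /uniform_subset_cvg /(_ h); rewrite uniform_set1; exact.
Qed.

Lemma trigB (V : normedModType R[i]) (P Q : nat -> V) j k (z : R[i]) :
  (0 < j)%N -> (j <= k)%N ->
  trig P Q k z - trig P Q j z =
  \sum_(j <= n < k) z ^+ n *: P n + \sum_(j <= n < k) z^* ^+ n *: Q n.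
Proof.
move=> j0 jk; rewrite /trig (big_cat_nat (leq0n j) jk) (big_cat_nat j0 jk) /=.
by rewrite addrACA [LHS]addrC addKr.
Qed.

(** On |z| = r the tails of the expansion are bounded by the tails of the absolutely
    convergent series at the point r, uniformly in z. *)
Lemma harmonic_trig_bound (f : R[i] -> bop H) (A B : nat -> bop H) (r e : R) :
  harmonic_expansion f A B -> (forall z : R[i], `|z| < 1 -> `|f z| <= 1) ->
  0 <= r < 1 -> 0 < e -> exists N, forall M, (N <= M)%N ->
    forall z : R[i], `|z| = r%:C%C ->
    opnorm (trig A (fun n => adjoint (B n)) M z) <= 1 + e.
Proof.
move=> hf f1 /andP[r0 r1] e0; have e2 := divr_gt0 e0 (ltr0Sn _ 1).
have rz : `|r%:C%C : R[i]| < 1 by rewrite ger0_norm ?lecR ?ltcR.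
have [NA hA] := abs_cvg_tail (absolute_analytic hf rz) e2.
have [NB hB] := abs_cvg_tail (absolute_antianalytic hf rz) e2.
exists (maxn 1 (maxn NA NB)) => M; rewrite !geq_max => /and3P[M0 MA MB] z zr.
have z1 : `|z| < 1 by rewrite zr ltcR.
have fz1 : opnorm (f z) <= 1 by have := f1 z z1; rewrite rnormE lecR.
have : rnorm (trig A (fun n => adjoint (B n)) M z - f z) <= e.
  apply: (rnorm_lim_le (N := M) (harmonic_trig_cvg hf z1)) => K MK.
  rewrite rnormB trigB// (le_trans (rnormD _ _))//.
  have nz (u : R[i]) n (C : bop H) : `|u| = r%:C%C ->
      rnorm (u ^+ n *: C) = rnorm (r%:C%C ^+ n *: C : bop H).
    by move=> ur; rewrite !rnormZ !normrX ur [`|r%:C%C|]ger0_norm ?lecR.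
  have rr : `|r%:C%C^* : R[i]| = r%:C%C by rewrite norm_conjC ger0_norm ?lecR.
  have sum_le (u u' : R[i]) (C : nat -> bop H) : `|u| = r%:C%C -> `|u'| = r%:C%C ->
      rnorm (\sum_(M <= n < K) u ^+ n *: C n) <= \sum_(M <= n < K) rnorm (u' ^+ n *: C n).
    move=> ur ur'; rewrite (le_trans (rnorm_sum _ _ _))//.
    by apply: ler_sum => n _; rewrite (nz u)// (nz u').
  rewrite [leRHS]splitr lerD//.
    by rewrite (le_trans (sum_le z r%:C%C _ _ _)) ?hA// ger0_norm ?lecR.
  by rewrite (le_trans (sum_le z^* r%:C%C^* _ _ _)) ?hB// norm_conjC.
move=> h; rewrite -[trig _ _ _ _](subrK (f z)) (le_trans (opnormD _ _))//.
by rewrite addrC lerD.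
Qed.

End HarmonicBound.

(** * Coefficient inequalities *)

Section RadialLimit.
Variable R : realType.

Lemma bernoulli (d : R) m : 0 <= d <= 1 -> 1 - m%:R * d <= (1 - d) ^+ m.
Proof.
move=> /andP[d0 d1]; elim: m => [|m IHm]; first by rewrite mul0r subr0 expr0.
have d1' : 0 <= 1 - d by rewrite subr_ge0.
rewrite exprS; apply: le_trans (ler_wpM2l d1' IHm).
have : 0 <= m%:R * d ^+ 2 by rewrite mulr_ge0 ?sqr_ge0.
rewrite -[m.+1]addn1 natrD; move: m%:R => a; nra.
Qed.

(** Letting the radius 1 - d tend to 1 in an estimate with error O(d), by Bernoulli's
    inequality for (1 - d)^m. *)
Lemma radial_limit (S X K : R) m : 0 <= S ->
  (forall d, 0 < d <= 1 -> (1 - d) ^+ m * S <= X + d * K) -> S <= X.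
Proof.
move=> S0 h; apply/ler_addgt0Pr => e e0.
pose L := `|K| + m%:R * S + 1.
have L1 : 1 <= L by rewrite lerDr addr_ge0// mulr_ge0.
have L0 : 0 < L by rewrite (lt_le_trans ltr01).
pose d := Num.min 1 (e / L).
have d0 : 0 < d by rewrite lt_min ltr01 divr_gt0.
have d1 : d <= 1 by rewrite ge_min lexx.
have dL : d * L <= e by rewrite -ler_pdivlMr// ge_min lexx orbT.
have := h d; rewrite d0 d1 => /(_ isT).
have := @bernoulli d m; rewrite (ltW d0) d1 => /(_ isT) /(ler_wpM2r S0).
have : d * K <= d * `|K| by rewrite ler_wpM2l ?(ltW d0)// ler_norm.
move: dL; rewrite /L; move: `|K| m%:R ((1 - d) ^+ m * S) => k a b; nra.
Qed.

End RadialLimit.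

Section SquareSum.
Variables (R : realType) (H : hilbertType R).
Implicit Types (P Q A B : nat -> bop H) (T : bop H).

(** The contractivity of a harmonic function read off its coefficients, through the partial
    sums on circles.  Unlike the function itself, they are trigonometric polynomials. *)
Definition boundary_contractive P Q := forall r e : R, 0 <= r < 1 -> 0 < e ->
  exists N, forall M, (N <= M)%N -> forall z : R[i], `|z| = r%:C%C ->
  opnorm (trig P Q M z) <= 1 + e.

(** Parseval on the circle of radius 1 - d.  The M-th partial sums have only exponents below
    M, so the radial weights are at least (1 - d)^(2 M). *)
Lemma square_sum_le P Q x M : boundary_contractive P Q ->
  \sum_(0 <= n < M) rnorm (P n x) ^+ 2 + \sum_(1 <= n < M) rnorm (Q n x) ^+ 2 <=
  rnorm x ^+ 2.
Proof.
move=> h; pose X := rnorm x ^+ 2.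
apply: (@radial_limit R _ X (3 * X) M.*2).
  by rewrite addr_ge0// sumr_ge0// => n _; rewrite sqr_ge0.
move=> d /andP[d0 d1]; pose r := 1 - d.
have r0 : 0 <= r by rewrite subr_ge0.
have r1 : r < 1 by rewrite /r; lra.
have [|N hN] := h r d _ d0; first by rewrite r0 r1.
(* The polynomial has to be long enough for the bound 1 + d and for the index M. *)
pose K := maxn 1 (maxn M N).
have K0 : (0 < K)%N by rewrite leq_max.
have MK : (M <= K)%N by rewrite /K; lia.
have NK : (N <= K)%N by rewrite /K; lia.
have := @trig_parseval R H (P^~ x) (Q^~ x) K r ((1 + d) * rnorm x) K0 r0.
have dx : 0 <= (1 + d) * rnorm x by rewrite mulr_ge0 ?rnorm_ge0// addr_ge0 ?(ltW d0).
move=> /(_ dx) par.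
have : ((1 + d) * rnorm x) ^+ 2 <= X + d * (3 * X).
  have : 0 <= d * (1 - d) * X by rewrite mulr_ge0 ?sqr_ge0// mulr_ge0 ?subr_ge0// ltW.
  by rewrite exprMn -/X; move: X => Y; nra.
apply: le_trans; apply: le_trans (par _) => [|z zr].
  have ext (F G : nat -> R) m : (forall n, (n < M)%N -> r ^+ M.*2 * F n <= G n) ->
      (forall n, 0 <= G n) -> r ^+ M.*2 * \sum_(m <= n < M) F n <= \sum_(m <= n < K) G n.
    move=> FG G0; have [Mm|mM] := leqP M m.
      by rewrite big_geq// mulr0 sumr_ge0.
    rewrite (big_cat_nat (ltnW mM) MK) /= -[leLHS]addr0 lerD ?sumr_ge0//.
    by rewrite mulr_sumr; apply: ler_sum_nat => n /andP[_ nM]; exact: FG.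
  rewrite mulrDr lerD// ext// => n; rewrite ?sqr_ge0// => nM.
    rewrite exprMn -exprM ler_wpM2r ?sqr_ge0// ler_wiXn2l ?(ltW r1)//.
    by rewrite muln2 leq_double ltnW.
  rewrite exprMn -exprM ler_wpM2r ?sqr_ge0// ler_wiXn2l ?(ltW r1)//.
  by rewrite muln2 leq_double ltnW.
rewrite -trig_bopE (le_trans (opnorm_rle _ _))// ler_wpM2r ?rnorm_ge0//.
exact: hN.
Qed.

End SquareSum.

Section RealPart.
Variables (R : realType) (H : hilbertType R).
Implicit Types (A B : nat -> bop H) (T S : bop H).

Lemma inner_ext (x y : H) : (forall z, inner z x = inner z y) -> x = y.
Proof.
move=> h; apply/eqP; rewrite -subr_eq0; apply/eqP/rnorm_eq0/eqP.
by rewrite -sqrf_eq0 -rinE /rin innerBr h subrr /= eqxx.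
Qed.

Lemma adjoint_unique T S : (forall x y, inner (T x) y = inner x (S y)) -> adjoint T = S.
Proof. by move=> h; apply: bop_ext => y; apply: inner_ext => x; rewrite -adjointP. Qed.

Lemma adjointD T S : adjoint (T + S) = adjoint T + adjoint S.
Proof.
by apply: adjoint_unique => x y; rewrite !bopDE innerDl innerDr !adjointP.
Qed.

Lemma adjointZ (a : R[i]) T : adjoint (a *: T) = a^* *: adjoint T.
Proof.
by apply: adjoint_unique => x y; rewrite !bopZE innerZl innerZr adjointP [(_^*)%C]conjCK.
Qed.

Lemma adjointK T : adjoint (adjoint T) = T.
Proof.
by apply: adjoint_unique => x y; rewrite innerC -adjointP -innerC.
Qed.

Lemma adjoint_sum (I : Type) (s : seq I) (F : I -> bop H) :
  adjoint (\sum_(i <- s) F i) = \sum_(i <- s) adjoint (F i).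
Proof.
elim: s => [|i s IHs]; last by rewrite !big_cons adjointD IHs.
by rewrite !big_nil; apply: adjoint_unique => x y; rewrite /= linear0l linear0r.
Qed.

Lemma opRe_sym T : symop (opRe T).
Proof.
have -> : opRe T = (2^-1)%:C%C *: (T + adjoint T) by rewrite /opRe rmorphV ?unitfE// rmorph_nat.
have adjl x y : rin (adjoint T x) y = rin x (T y) by rewrite rinC -rin_adjoint rinC.
by apply: symopZ => x y; rewrite !bopDE rinDl rinDr rin_adjoint adjl addrC.
Qed.

Lemma opnorm_opRe T : opnorm (opRe T) <= opnorm T.
Proof.
have -> : opRe T = (2^-1)%:C%C *: (T + adjoint T) by rewrite /opRe rmorphV ?unitfE// rmorph_nat.
rewrite opnormZ_real ?invr_ge0// ler_pdivrMl// (le_trans (opnormD _ _))//.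
by rewrite mulr_natl mulr2n lerD2l opnorm_adjoint.
Qed.

(** The analytic coefficients of Re (a f); its antianalytic coefficients are their
    adjoints. *)
Definition re_coef (a : R[i]) A B n : bop H :=
  if n is 0 then opRe (a *: A 0%N) else 2^-1 *: (a *: A n + a^* *: B n).

Lemma trig_re_coef (a : R[i]) A B M z : (0 < M)%N ->
  trig (re_coef a A B) (fun n => adjoint (re_coef a A B n)) M z =
  opRe (a *: trig A (fun n => adjoint (B n)) M z).
Proof.
move=> M0.
have analyticE : \sum_(1 <= n < M) z ^+ n *: re_coef a A B n =
    2^-1 *: (\sum_(1 <= n < M) a *: (z ^+ n *: A n) +
             \sum_(1 <= n < M) adjoint (a *: (z^* ^+ n *: adjoint (B n)))).
  rewrite -big_split scaler_sumr; apply: eq_big_nat => -[|n]// _ /=.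
  rewrite !adjointZ adjointK rmorphXn /= conjCK !scalerDr !scalerA.
  by congr (_ *: _ + _ *: _); ring.
have antianalyticE : \sum_(1 <= n < M) z^* ^+ n *: adjoint (re_coef a A B n) =
    2^-1 *: (\sum_(1 <= n < M) a *: (z^* ^+ n *: adjoint (B n)) +
             \sum_(1 <= n < M) adjoint (a *: (z ^+ n *: A n))).
  have half : (2^-1 : R[i])^* = 2^-1 by rewrite conj_Creal// rpredV rpred_nat.
  rewrite -big_split scaler_sumr; apply: eq_big_nat => -[|n]// _ /=.
  rewrite !(adjointZ, adjointD) rmorphXn /= conjCK half !scalerDr !scalerA addrC.
  by congr (_ *: _ + _ *: _); ring.
rewrite /trig !(big_ltn M0) !expr0 !scale1r analyticE antianalyticE.
rewrite /re_coef /opRe -!scalerDr !(scalerDr a) !scaler_sumr !adjointD !adjoint_sum.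
by congr (_ *: _); rewrite (AC ((2*2)*2) (((1*3)*5)*((2*6)*4))).
Qed.

Lemma re_coef_contractive (a : R[i]) A B : `|a| = 1 ->
  boundary_contractive A (fun n => adjoint (B n)) ->
  boundary_contractive (re_coef a A B) (fun n => adjoint (re_coef a A B n)).
Proof.
move=> a1 h r e r01 e0; have [N hN] := h r e r01 e0.
exists (maxn 1 N) => M; rewrite geq_max => /andP[M0 NM] z zr.
rewrite trig_re_coef// (le_trans (opnorm_opRe _))// -rnorm_bop rnormZ a1 mul1r.
exact: hN.
Qed.

End RealPart.
Section WeightedCauchySchwarz.
Variable R : realType.

(** Cauchy-Schwarz with the weights inside al and be.  It follows from
    2 c <= u al + be / u for every u > 0, with u close to X / s; the case s = 0 needs u to tend to
    infinity instead. *)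
Lemma sum_le_cauchy_schwarz (I : Type) (t : seq I) (c al be : I -> R) (s X : R) :
  0 <= s -> 0 <= X -> (forall i, 0 <= al i) -> (forall i, 0 <= be i) ->
  (forall i, c i ^+ 2 <= al i * be i) ->
  \sum_(i <- t) al i <= s ^+ 2 -> \sum_(i <- t) be i <= X ^+ 2 ->
  \sum_(i <- t) c i <= s * X.
Proof.
move=> s0 X0 al0 be0 h hs hX.
have amgm u : 0 < u -> 2 * \sum_(i <- t) c i <= u * s ^+ 2 + u^-1 * X ^+ 2.
  move=> u0; have iu0 : 0 <= u^-1 by rewrite invr_ge0 ltW.
  rewrite (@le_trans _ _ (\sum_(i <- t) (u * al i + u^-1 * be i)))//; last first.
    by rewrite big_split -!mulr_sumr lerD// ler_wpM2l ?(ltW u0).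
  rewrite mulr_sumr; apply: ler_sum => i _.
  have q0 : 0 <= u * al i + u^-1 * be i by rewrite addr_ge0 ?mulr_ge0// ltW.
  rewrite (le_trans (ler_norm _))// -(@ler_pXn2r _ 2)// ?nnegrE// real_normK ?num_real//.
  have ab : (u * al i) * (u^-1 * be i) = al i * be i by rewrite mulrACA divff ?mul1r ?gt_eqF.
  have := sqr_ge0 (u * al i - u^-1 * be i); have := h i; rewrite -ab.
  move: (u * al i) (u^-1 * be i) => y z; nra.
have [s_eq0|s_neq0] := eqVneq s 0.
  apply/ler_addgt0Pr => e e0; have XX0 : 0 < X ^+ 2 + 1 by rewrite ltr_wpDl// sqr_ge0.
  have := amgm _ (divr_gt0 XX0 e0).
  have : (X ^+ 2 + 1)^-1 * X ^+ 2 <= 1 by rewrite mulrC ler_pdivrMr// mul1r lerDl.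
  move=> /(ler_wpM2l (ltW e0)).
  rewrite s_eq0 invf_div expr0n mulr0 add0r mul0r; lra.
have sp : 0 < s by rewrite lt_def s_neq0.
apply/ler_addgt0Pr => e e0; pose Y := X + e / s.
have es : 0 < e / s by rewrite divr_gt0.
have Y0 : 0 < Y by rewrite ltr_wpDl.
have := amgm _ (divr_gt0 Y0 sp); rewrite invf_div.
have -> : Y / s * s ^+ 2 = s * Y by field; rewrite gt_eqF.
have : s / Y * X ^+ 2 <= s * Y.
  rewrite -mulrA ler_wpM2l// mulrC ler_pdivrMr// -expr2 ler_pXn2r ?nnegrE ?(ltW Y0)//.
  by rewrite lerDl ltW.
have -> : s * Y = s * X + e by rewrite mulrDr mulrCA divff ?mulr1 ?gt_eqF.
lra.
Qed.

Lemma sum_geometric_le (q : R) N : 0 <= q < 1 -> \sum_(1 <= n < N) q ^+ n <= q / (1 - q).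
Proof.
move=> /andP[q0 q1]; have d0 : 0 < 1 - q by rewrite subr_gt0.
case: N => [|N]; first by rewrite big_geq// divr_ge0// ltW.
have -> : \sum_(1 <= n < N.+1) q ^+ n = (q - q ^+ N.+1) / (1 - q).
  elim: N => [|N IHN]; first by rewrite big_geq// expr1 subrr mul0r.
  rewrite big_nat_recr//= IHN (exprS _ N.+1); field; exact: lt0r_neq0.
by rewrite ler_wpM2r ?invr_ge0 ?(ltW d0)// gerBl exprn_ge0.
Qed.

Lemma nondecreasing_sum1 (v : nat -> R) (K : R) :
  (forall n, 0 <= v n) -> (forall N, \sum_(1 <= n < N) v n <= K) ->
  exists2 l : R, has_sum1 (fun n => (v n)%:C%C : R[i]) l%:C%C & l <= K.
Proof.
move=> v0 vK; pose s N := \sum_(1 <= n < N) v n.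
have ss : has_sup (range s).
  by split; [exists (s 0%N), 0%N | exists K => _ [n _ <-]; exact: vK].
exists (sup (range s)); last by apply: ge_sup => [|_ [n _ <-]]; [case: ss | exact: vK].
apply/(@cvg_rnormP R R[i]) => e e0.
have [_ [N _ <-] hN] := sup_adherent e0 ss; exists N => n Nn.
have sn : s n <= sup (range s) by apply: sup_upper_bound => //; exists n.
have Nsn : s N <= s n.
  have [N0|N0] := ltnP 0 N.
    by rewrite /s (big_cat_nat N0 Nn) /= lerDl sumr_ge0.
  by rewrite /s (@big_geq _ _ _ 1 N) ?(leq_trans N0)// sumr_ge0.
rewrite -rmorph_sum rnormB -rmorphB rnorm_real ?subr_ge0//.
by move: hN Nsn; rewrite /s; lra.
Qed.

End WeightedCauchySchwarz.

Section Coefficients.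
Variables (R : realType) (H : hilbertType R).
Implicit Types (A B P Q : nat -> bop H) (T : bop H).

Lemma has_sum1_geometric (v : nat -> bop H) (L r : R) : 0 <= r < 1 -> 0 <= L ->
  (forall n, (0 < n)%N -> opnorm (v n) <= L * r ^+ n) ->
  exists S : bop H, has_sum1 v S.
Proof.
move=> r01 L0 h.
have step N : opnorm (\sum_(1 <= n < N.+1) v n - \sum_(1 <= n < N) v n) <=
    L * \sum_(1 <= n < N.+1) r ^+ n - L * \sum_(1 <= n < N) r ^+ n.
  case: N => [|N]; first by rewrite !big_geq// !subrr -rnorm_bop rnorm0.
  rewrite (big_nat_recr N.+1)//= (big_nat_recr N.+1 1%N (fun n => r ^+ n))//=.
  by rewrite mulrDr ![_ + _ - _]addrAC !subrr !add0r h.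
have [N|S] := bop_cvg_dominated step (M := L * (r / (1 - r))); last by exists S.
by rewrite ler_wpM2l// sum_geometric_le.
Qed.

Lemma contractive_coef_le1 P Q n : boundary_contractive P Q ->
  opnorm (P n) <= 1 /\ ((0 < n)%N -> opnorm (Q n) <= 1).
Proof.
move=> h; have sq_le (T : bop H) : (forall x, rnorm (T x) ^+ 2 <= rnorm x ^+ 2) -> opnorm T <= 1.
  move=> hT; apply: opnorm_le_bound => // x.
  by rewrite mul1r -(@ler_pXn2r _ 2)// ?nnegrE ?rnorm_ge0.
have sum0 m k (F : nat -> bop H) x : 0 <= \sum_(m <= i < k) rnorm (F i x) ^+ 2.
  by rewrite sumr_ge0// => i _; rewrite sqr_ge0.
split=> [|n0]; apply: sq_le => x; have := square_sum_le x n.+1 h.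
  rewrite (big_nat_recr n 0%N)//=.
  by have := sum0 0%N n P x; have := sum0 1%N n.+1 Q x; lra.
rewrite (big_nat_recr n 1%N)//=.
by have := sum0 0%N n.+1 P x; have := sum0 1%N n Q x; lra.
Qed.

Lemma normalop_rnorm T x : normalop T -> rnorm (adjoint T x) = rnorm (T x).
Proof.
move=> nT; apply/eqP; rewrite -(@eqrXn2 _ 2)// ?rnorm_ge0//; apply/eqP.
by rewrite -!rinE -rin_adjoint -opcompE -nT opcompE rinC -rin_adjoint.
Qed.

(** The function (1 + d) I - Re (a f) is positive on the circle of radius 1 - d, up to
    truncation, with value d I + (I - Re (a A_0)) at 0.  Comparing its n-th coefficient with
    this value by [trig_positive], and letting d tend to 0, bounds Re <C_n x, y> by
    |I - Re (a A_0)| (|x|^2 + |y|^2), where C_n = a A_n + a^* B_n. *)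
Lemma opnorm_re_coef_le (a : R[i]) A B n : `|a| = 1 -> (0 < n)%N ->
  boundary_contractive A (fun n => adjoint (B n)) ->
  opnorm (a *: A n + a^* *: B n) <= 2 * opnorm (idop H - opRe (a *: A 0%N)).
Proof.
move=> a1 n0 h; set D := opnorm (idop H - _).
have recE : re_coef a A B n = 2^-1 *: (a *: A n + a^* *: B n) by case: n n0.
set T := _ + _ in recE *.
have D0 : 0 <= D by exact: opnorm_ge0.
have key x y : rin (T x) y <= D * (rnorm x ^+ 2 + rnorm y ^+ 2).
  have X0 : 0 <= D * (rnorm x ^+ 2 + rnorm y ^+ 2) by rewrite mulr_ge0 ?addr_ge0 ?sqr_ge0.
  have [T0|T0] := ltP (rin (T x) y) 0; first exact: le_trans (ltW T0) X0.
  apply: (@radial_limit R _ _ (rnorm x ^+ 2 + rnorm y ^+ 2) n) => // d /andP[d0 d1].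
  have [|N hN] := re_coef_contractive a1 h (r := 1 - d) _ d0; first by apply/andP; lra.
  pose M := maxn n.+1 N.
  have nM : (n < M)%N by rewrite leq_max leqnn.
  have NM : (N <= M)%N by rewrite leq_max leqnn orbT.
  (* The coefficients of the constant function (1 + d) I. *)
  pose E m : bop H := if m is 0 then (1 + d)%:C%C *: idop H else 0.
  have trigE z : trig (fun m => E m - re_coef a A B m)
      (fun m => - adjoint (re_coef a A B m)) M z =
      (1 + d)%:C%C *: idop H - trig (re_coef a A B) (fun m => adjoint (re_coef a A B m)) M z.
    have -> : (1 + d)%:C%C *: idop H = \sum_(0 <= m < M) z ^+ m *: E m.
      rewrite big_ltn ?(leq_trans _ nM)// expr0 scale1r big_nat big1 ?addr0//.
      by move=> [|m]// _; rewrite scaler0.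
    rewrite /trig opprD addrA -sumrB -sumrN; congr (_ + _); apply: eq_bigr => m _.
      by rewrite scalerBr.
    by rewrite scalerN.
  have r0 : 0 <= 1 - d by rewrite subr_ge0.
  have pos z : `|z| = (1 - d)%:C%C -> ople 0 (trig (fun m => E m - re_coef a A B m)
      (fun m => - adjoint (re_coef a A B m)) M z).
    move=> zr; have M0 : (0 < M)%N := leq_trans (ltn0Sn n) nM.
    rewrite trigE trig_re_coef//; set W := opRe _.
    have sW : symop W by exact: opRe_sym.
    have W1 : opnorm W <= 1 + d by rewrite /W -trig_re_coef// hN.
    apply: ople_rin => [||v]; [exact: symop0 | exact/symopB/sW/symopZ/symop_id |].
    rewrite {1}/rin linear0l bopBE bopZE idopE rinDl rinNl rinZl rinE subr_ge0.
    rewrite (le_trans (rin_le _ _))// expr2 mulrA ler_wpM2r ?rnorm_ge0//.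
    by rewrite (le_trans (opnorm_rle _ _))// ler_wpM2r ?rnorm_ge0.
  have := trig_positive x (- y) r0 nM pos.
  have diag (v : H) : rin ((E 0%N - re_coef a A B 0) v) v <= (d + D) * rnorm v ^+ 2.
    have -> : E 0%N - re_coef a A B 0 = d%:C%C *: idop H + (idop H - opRe (a *: A 0%N)).
      by rewrite /= rmorphD scalerDl scale1r addrA (addrC (idop H)).
    rewrite bopDE rinDl bopZE rinZl rinE mulrDl lerD2l (le_trans (rin_le _ _))//.
    by rewrite expr2 mulrA ler_wpM2r ?rnorm_ge0// opnorm_rle.
  have := diag x; have := diag (- y); rewrite rnormN.
  have -> : E n - re_coef a A B n = (- 2^-1)%:C%C *: T.
    have -> : E n = 0 by rewrite /E -(prednK n0).
    by rewrite recE sub0r rmorphN rmorphV ?unitfE// rmorph_nat scaleNr.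
  rewrite bopZE rinZl rinNr; lra.
apply: opnorm_le_bound => [|x]; first by rewrite mulr_ge0.
have [Tx0|Tx0] := eqVneq (rnorm (T x)) 0; first by rewrite Tx0 !mulr_ge0 ?rnorm_ge0.
have [x0|x0] := eqVneq (rnorm x) 0.
  by rewrite (rnorm_eq0 x0) linear0 !rnorm0 mulr0.
have Tp : 0 < rnorm (T x) by rewrite lt_def Tx0 rnorm_ge0.
have xp : 0 < rnorm x by rewrite lt_def x0 rnorm_ge0.
(* Choose y of norm |x| in the direction of T x. *)
have := key x ((rnorm x / rnorm (T x))%:C%C *: T x).
have q0 : 0 <= rnorm x / rnorm (T x) by rewrite divr_ge0 ?rnorm_ge0.
rewrite rinZr rinE -(rinE (_ *: _)) rinZl rinZr rinE.
have -> : rnorm x / rnorm (T x) * rnorm (T x) ^+ 2 = rnorm x * rnorm (T x).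
  by field; rewrite gt_eqF.
have -> : rnorm x / rnorm (T x) * (rnorm x * rnorm (T x)) = rnorm x ^+ 2.
  by field; rewrite gt_eqF.
by move=> h'; rewrite -(ler_pM2l xp); move: h'; congr (_ <= _); ring.
Qed.

(** Cauchy-Schwarz applied to r^n |C_n x| = (k^(-1/2) r^n) (k^(1/2) |C_n x|), the term of index 0
    being |G x|. *)
Lemma abs_sum_le (C : nat -> bop H) (G : bop H) (k r s : R) x N :
  0 <= r < 1 -> 0 < k -> 0 <= s -> s ^+ 2 = 1 + k^-1 * (r ^+ 2 / (1 - r ^+ 2)) ->
  rnorm (G x) ^+ 2 + k * \sum_(1 <= n < N.+1) rnorm (C n x) ^+ 2 <= rnorm x ^+ 2 ->
  rin ((opabs G + \sum_(1 <= n < N.+1) (r%:C%C) ^+ n *: opabs (C n)) x) x <=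
  s * rnorm x ^+ 2.
Proof.
move=> r01 k0 s0 sE h; have /andP[r0 r1] := r01.
pose al n := if n is 0 then 1 else k^-1 * (r ^+ 2) ^+ n.
pose be n := if n is 0 then rnorm (G x) ^+ 2 else k * rnorm (C n x) ^+ 2.
pose c n := if n is 0 then rnorm (G x) else r ^+ n * rnorm (C n x).
have r2 : 0 <= r ^+ 2 < 1 by rewrite exprn_ge0//= exprn_ilt1.
have ltrim (F F' : nat -> R) : (forall n, F n.+1 = F' n.+1) ->
    \sum_(1 <= n < N.+1) F n = \sum_(1 <= n < N.+1) F' n.
  by move=> FF; apply: eq_big_nat => -[|n].
have : \sum_(0 <= n < N.+1) c n <= s * rnorm x.
  apply: (@sum_le_cauchy_schwarz _ _ _ _ al be) => //.
  - exact: rnorm_ge0.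
  - by case=> // n; rewrite mulr_ge0 ?invr_ge0 ?(ltW k0) ?exprn_ge0.
  - by case=> [|n]; rewrite ?sqr_ge0// mulr_ge0 ?sqr_ge0 ?(ltW k0).
  - case=> [|n]; rewrite /c /al /be /= ?mul1r// exprMn (mulrACA k^-1) mulVf ?gt_eqF// mul1r.
    by rewrite -!exprM mulnC.
  - rewrite big_ltn// (ltrim _ (fun n => k^-1 * (r ^+ 2) ^+ n))// -mulr_sumr sE.
    by rewrite lerD2l ler_wpM2l ?invr_ge0 ?(ltW k0)// sum_geometric_le.
  - by rewrite big_ltn// (ltrim _ (fun n => k * rnorm (C n x) ^+ 2))// -mulr_sumr.
move=> /(ler_wpM2r (rnorm_ge0 x)); rewrite -mulrA -expr2; apply: le_trans.
rewrite [in leRHS]big_ltn// (ltrim c (fun n => r ^+ n * rnorm (C n x)))// mulrDl.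
rewrite bopDE rinDl lerD ?rin_opabs// bop_sumE rin_suml mulr_suml.
apply: ler_sum => n _; rewrite bopZE -rmorphXn rinZl -mulrA.
by rewrite ler_wpM2l ?exprn_ge0// rin_opabs.
Qed.

Lemma expiN (mu : R) : expi (- mu) = (expi mu)^*.
Proof. by rewrite /expi cosN sinN. Qed.

Lemma norm_expi (mu : R) : `|expi mu| = 1.
Proof. by rewrite normc_def /= cos2Dsin2 sqrtr1. Qed.

End Coefficients.

(** * Bohr inequalities *)

Section Bohr.
Variables (R : realType) (H : hilbertType R).
Implicit Types (A B C : nat -> bop H) (x : H).

Lemma re_coef_square_sum (a : R[i]) A B x N : `|a| = 1 ->
  boundary_contractive A (fun n => adjoint (B n)) ->
  rnorm (opRe (a *: A 0%N) x) ^+ 2 +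
    \sum_(1 <= n < N.+1) rnorm (re_coef a A B n x) ^+ 2 +
    \sum_(1 <= n < N.+1) rnorm (adjoint (re_coef a A B n) x) ^+ 2 <= rnorm x ^+ 2.
Proof.
move=> a1 /(re_coef_contractive a1) h; have := square_sum_le x N.+1 h.
by rewrite big_ltn.
Qed.

Lemma rnorm_re_coef (a : R[i]) A B x n : (0 < n)%N ->
  rnorm (re_coef a A B n x) ^+ 2 = 4^-1 * rnorm ((a *: A n + a^* *: B n) x) ^+ 2.
Proof.
case: n => // n _; rewrite /re_coef bopZE rnormZ normrV ?unitfE// normr_nat.
by rewrite -(rmorph_nat (real_complex R)) -rmorphV ?unitfE//= exprMn; congr (_ * _); field.
Qed.

Lemma rnorm_adjoint_re_coef (a : R[i]) A B x n : (0 < n)%N ->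
  normalop (a *: A n + a^* *: B n) ->
  rnorm (adjoint (re_coef a A B n) x) = rnorm (re_coef a A B n x).
Proof.
case: n => // n _ nC; rewrite /re_coef adjointZ !bopZE !rnormZ norm_conjC.
by rewrite normalop_rnorm.
Qed.

Lemma ople_abs_sum C (G S : bop H) (k r s : R) :
  0 <= r < 1 -> 0 < k -> 0 <= s -> s ^+ 2 = 1 + k^-1 * (r ^+ 2 / (1 - r ^+ 2)) ->
  (forall x N, rnorm (G x) ^+ 2 + k * \sum_(1 <= n < N.+1) rnorm (C n x) ^+ 2
     <= rnorm x ^+ 2) ->
  has_sum1 (fun n => (r%:C%C) ^+ n *: opabs (C n)) S ->
  ople (opabs G + S) (s%:C%C *: idop H).
Proof.
move=> r01 k0 s0 sE h hS.
pose u N := opabs G + \sum_(1 <= n < N.+1) (r%:C%C) ^+ n *: opabs (C n).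
apply: (@ople_lim _ _ u).
- apply: cvgD; first exact: cvg_cst.
  by have := hS; rewrite /has_sum1 -cvg_shiftS.
- move=> N; apply: symopD; first exact: opabs_sym.
  elim/big_ind : _ => [|T T'|n _]; [exact: symop0 | exact: symopD |].
  by rewrite -rmorphXn; apply/symopZ/opabs_sym.
- by move=> N x; apply: (abs_sum_le r01 k0 s0 sE).
Qed.

Lemma has_sum1_opabs C (r L : R) : 0 <= r < 1 -> 0 <= L ->
  (forall n, (0 < n)%N -> opnorm (C n) <= L) ->
  exists S : bop H, has_sum1 (fun n => (r%:C%C) ^+ n *: opabs (C n)) S.
Proof.
move=> r01 L0 CL; apply: (has_sum1_geometric r01 L0) => n n0.
have /andP[r0 _] := r01.
rewrite -rmorphXn opnormZ_real ?exprn_ge0// mulrC ler_wpM2r ?exprn_ge0//.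
by rewrite (le_trans (opnorm_opabs _))// CL.
Qed.

Lemma sqrt_ratio_sqr (k r : R) : 0 <= r < 1 -> 0 < k ->
  (Num.sqrt (1 + (k^-1 - 1) * r ^+ 2) / Num.sqrt (1 - r ^+ 2)) ^+ 2 =
  1 + k^-1 * (r ^+ 2 / (1 - r ^+ 2)).
Proof.
move=> /andP[r0 r1] k0; have r2 : 0 < 1 - r ^+ 2 by rewrite subr_gt0 exprn_ilt1.
have q0 : 0 <= 1 + (k^-1 - 1) * r ^+ 2.
  have : 0 <= k^-1 * r ^+ 2 by rewrite mulr_ge0 ?sqr_ge0// invr_ge0 ltW.
  by move: r2; rewrite mulrBl mul1r; lra.
rewrite expr_div_n !sqr_sqrtr// ?(ltW r2)//.
by field; rewrite !gt_eqF.
Qed.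

(** [ople_abs_sum] applies with k = 1/4 since the coefficients of Re (a f) are C_n / 2.  If
    C_n is normal then the antianalytic coefficients contribute as much as the analytic ones
    and k = 1/2. *)
Lemma abs_sum_harmonic (a : R[i]) A B (r : R) : `|a| = 1 -> 0 <= r < 1 ->
  boundary_contractive A (fun n => adjoint (B n)) ->
  let C n := a *: A n + a^* *: B n in
  exists2 S : bop H, has_sum1 (fun n => (r%:C%C) ^+ n *: opabs (C n)) S &
    ople (opabs (opRe (a *: A 0%N)) + S)
      ((Num.sqrt (1 + 3 * r ^+ 2) / Num.sqrt (1 - r ^+ 2))%:C%C *: idop H) /\
    ((forall n, (0 < n)%N -> normalop (C n)) ->
     ople (opabs (opRe (a *: A 0%N)) + S)
      ((Num.sqrt (1 + r ^+ 2) / Num.sqrt (1 - r ^+ 2))%:C%C *: idop H)).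
Proof.
move=> a1 r01 h C.
have [|n n0|S hS] := @has_sum1_opabs C r (2 * opnorm (idop H - opRe (a *: A 0%N))) r01.
- by rewrite mulr_ge0 ?opnorm_ge0.
- exact: opnorm_re_coef_le.
have sqr0 (F : nat -> H) N : 0 <= \sum_(1 <= n < N) rnorm (F n) ^+ 2.
  by rewrite sumr_ge0// => n _; rewrite sqr_ge0.
have s0 k : 0 <= Num.sqrt (1 + k * r ^+ 2) / Num.sqrt (1 - r ^+ 2).
  by rewrite divr_ge0 ?sqrtr_ge0.
exists S => //; split=> [|nC].
  apply: (@ople_abs_sum _ _ _ 4^-1 _ _ r01 _ _ _ _ hS) => //.
  - by rewrite -sqrt_ratio_sqr//; congr ((Num.sqrt (1 + _ * _) / _) ^+ 2); field.
  - move=> x N; apply: le_trans (re_coef_square_sum x N a1 h).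
    rewrite mulr_sumr -[leLHS]addr0 lerD ?sqr0// lerD2l le_eqVlt; apply/orP; left.
    by apply/eqP/eq_big_nat => n /andP[n0 _]; rewrite rnorm_re_coef.
rewrite -[in Num.sqrt (1 + _)](mul1r (r ^+ 2)).
apply: (@ople_abs_sum _ _ _ 2^-1 _ _ r01 _ _ _ _ hS) => //.
- by rewrite -sqrt_ratio_sqr//; congr ((Num.sqrt (1 + _ * _) / _) ^+ 2); field.
- move=> x N; apply: le_trans (re_coef_square_sum x N a1 h).
  rewrite -addrA -big_split /= mulr_sumr lerD2l le_eqVlt; apply/orP; left.
  apply/eqP/eq_big_nat => n /andP[n0 _].
  rewrite rnorm_adjoint_re_coef//; last exact: nC.
  by rewrite rnorm_re_coef// -/(C n); field.
Qed.

(** The geometric series 2 (r + r^2 + ...) = 2 r / (1 - r) is at most 1 for r <= 1/3. *)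
Lemma bohr_harmonic (a : R[i]) A B (r : R) : `|a| = 1 -> 0 <= r <= 1 / 3 ->
  boundary_contractive A (fun n => adjoint (B n)) ->
  exists2 s : R[i],
    has_sum1 (fun n => `|a *: A n + a^* *: B n| * (r%:C%C) ^+ n) s &
    s <= `|idop H - opRe (a *: A 0%N)|.
Proof.
move=> a1 /andP[r0 r13] h; set D := idop H - _.
have D0 : 0 <= opnorm D by exact: opnorm_ge0.
have r1 : 0 <= r < 1 by apply/andP; lra.
pose v n := opnorm (a *: A n + a^* *: B n) * r ^+ n.
have [n|N|l hl lD] := @nondecreasing_sum1 R v (opnorm D).
- by rewrite mulr_ge0 ?opnorm_ge0 ?exprn_ge0.
- rewrite (@le_trans _ _ (2 * opnorm D * \sum_(1 <= n < N) r ^+ n))//.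
    rewrite mulr_sumr; apply: ler_sum_nat => -[|n]// _.
    by rewrite ler_wpM2r ?exprn_ge0// opnorm_re_coef_le.
  rewrite (le_trans (ler_wpM2l _ (sum_geometric_le N r1))) ?mulr_ge0//.
  rewrite mulrAC ler_piMl//.
  by rewrite mulrA ler_pdivrMr; lra.
exists l%:C%C; last by rewrite bop_normE lecR.
have -> : (fun n => `|a *: A n + a^* *: B n| * (r%:C%C) ^+ n) = fun n => (v n)%:C%C.
  by apply/funext => n; rewrite bop_normE rmorphM rmorphXn.
exact: hl.
Qed.

(** Cauchy-Schwarz for the terms r^n (|A_n x| + |B_n^* x|), whose squares are at most
    2 r^(2n) (|A_n x|^2 + |B_n^* x|^2), with 2 r^2 / (1 - r^2) <= 1/4. *)
Lemma abs_sum_coefs A B (r : R) : 0 <= r <= 1 / 3 ->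
  boundary_contractive A (fun n => adjoint (B n)) ->
  exists S T : bop H,
    [/\ has_sum1 (fun n => (r%:C%C) ^+ n *: opabs (A n)) S,
        has_sum1 (fun n => (r%:C%C) ^+ n *: opabs (adjoint (B n))) T &
        ople (S + T) (2^-1 *: idop H)].
Proof.
move=> /andP[r0 r13] h; have r1 : 0 <= r < 1 by apply/andP; lra.
have [S hS] : exists S : bop H, has_sum1 (fun n => (r%:C%C) ^+ n *: opabs (A n)) S.
  by apply: (has_sum1_opabs r1 ler01) => n _; case: (contractive_coef_le1 n h).
have [T hT] : exists T : bop H,
    has_sum1 (fun n => (r%:C%C) ^+ n *: opabs (adjoint (B n))) T.
  by apply: (has_sum1_opabs r1 ler01) => n n0; case: (contractive_coef_le1 n h) => _ /(_ n0).
exists S, T; split=> //.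
rewrite (_ : 2^-1 = (2^-1)%:C%C); last by rewrite rmorphV ?unitfE// rmorph_nat.
have sym C N : symop (\sum_(1 <= n < N) (r%:C%C) ^+ n *: opabs (C n)).
  elim/big_ind : _ => [|X Y|n _]; [exact: symop0 | exact: symopD |].
  by rewrite -rmorphXn; apply/symopZ/opabs_sym.
pose u N : bop H := \sum_(1 <= n < N) (r%:C%C) ^+ n *: opabs (A n) +
  \sum_(1 <= n < N) (r%:C%C) ^+ n *: opabs (adjoint (B n)).
have uST : u @ \oo --> S + T by exact: cvgD hS hT.
apply: (ople_lim uST) => [N|N x]; first exact: symopD.
rewrite /u bopDE rinDl !bop_sumE !rin_suml -big_split.
pose c n := r ^+ n * (rnorm (A n x) + rnorm (adjoint (B n) x)).
rewrite (@le_trans _ _ ((\sum_(1 <= n < N) c n) * rnorm x))//.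
  rewrite mulr_suml; apply: ler_sum => n _.
  rewrite !bopZE -rmorphXn !rinZl /= -mulrDr -mulrA ler_wpM2l ?exprn_ge0// mulrDl.
  by rewrite lerD ?rin_opabs.
rewrite expr2 mulrA ler_wpM2r ?rnorm_ge0//.
apply: (@sum_le_cauchy_schwarz _ _ _ _ (fun n => 2 * (r ^+ 2) ^+ n)
  (fun n => rnorm (A n x) ^+ 2 + rnorm (adjoint (B n) x) ^+ 2)).
- by rewrite invr_ge0.
- exact: rnorm_ge0.
- by move=> n; rewrite mulr_ge0 ?exprn_ge0.
- by move=> n; rewrite addr_ge0 ?sqr_ge0.
- move=> n; rewrite /c exprMn -exprM mulnC exprM (mulrC 2) -(mulrA _ 2).
  rewrite ler_wpM2l ?exprn_ge0//.
  move: (rnorm _) (rnorm _) => p q; have := sqr_ge0 (p - q); nra.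
- rewrite -mulr_sumr; have r2 : 0 <= r ^+ 2 < 1 by rewrite exprn_ge0//= exprn_ilt1//; lra.
  rewrite (le_trans (ler_wpM2l _ (sum_geometric_le N r2)))//.
  by rewrite mulrA ler_pdivrMr ?subr_gt0; [nra | case/andP: r2].
- rewrite big_split /=; apply: le_trans (square_sum_le x N h); rewrite lerD2r.
  case: N => [|N]; first by rewrite !big_geq.
  by rewrite (@big_ltn _ _ _ 0%N)// lerDr sqr_ge0.
Qed.

End Bohr.

Theorem theorem1 (R : realType) (H : hilbertType R) (f : R[i] -> bop H)
    (A B : nat -> bop H)
    (f_harmonic : harmonic_expansion f A B)
    (f_le1 : forall z : R[i], `|z| < 1 -> `|f z| <= 1) :
  (forall (mu r : R), 0 <= r < 1 ->
    let C n := expi mu *: A n + expi (- mu) *: B n in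
    exists2 S : bop H, has_sum1 (fun n => (r%:C%C) ^+ n *: opabs (C n)) S &
      ople (opabs (opRe (expi mu *: A 0%N)) + S)
        ((Num.sqrt (1 + 3 * r ^+ 2) / Num.sqrt (1 - r ^+ 2))%:C%C *: idop H) /\
      ((forall n, (0 < n)%N -> normalop (C n)) ->
       ople (opabs (opRe (expi mu *: A 0%N)) + S)
        ((Num.sqrt (1 + r ^+ 2) / Num.sqrt (1 - r ^+ 2))%:C%C *: idop H))) /\
  (forall mu : R,
    let C n := expi mu *: A n + expi (- mu) *: B n in
    let bohr_le (r : R) := exists2 s : R[i],
      has_sum1 (fun n => `|C n| * (r%:C%C) ^+ n) s &
      s <= `|idop H - opRe (expi mu *: A 0%N)| in
    (forall r : R, 0 <= r <= 1 / 5 -> bohr_le r) /\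
    ((forall n, (0 < n)%N -> normalop (C n)) ->
     forall r : R, 0 <= r <= 1 / 3 -> bohr_le r)) /\
  (forall r : R, 0 <= r <= 1 / 3 ->
    exists S T : bop H,
      [/\ has_sum1 (fun n => (r%:C%C) ^+ n *: opabs (A n)) S,
          has_sum1 (fun n => (r%:C%C) ^+ n *: opabs (adjoint (B n))) T &
          ople (S + T) (2^-1 *: idop H)]).
Proof.
have h : boundary_contractive A (fun n => adjoint (B n)).
  by move=> r e; exact: harmonic_trig_bound f_harmonic f_le1.
split; last split.
- move=> mu r r01 C; rewrite /C expiN.
  exact: abs_sum_harmonic (norm_expi mu) r01 h.
- move=> mu C bohr_le.
  have bohr r : 0 <= r <= 1 / 3 -> bohr_le r.
    move=> r13; rewrite /bohr_le /C expiN.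
    exact: bohr_harmonic (norm_expi mu) r13 h.
  by split=> [r /andP[r0 r5]|_ //]; apply: bohr; apply/andP; lra.
- by move=> r r13; exact: abs_sum_coefs.
Qed.
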